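(* Let $1\le p\le\infty$ and $0<\alpha<1$. Then for $1\le q<\infty$ and $0<\epsilon<\alpha$ we have $L^{\alpha,p}\hookrightarrow B^{\alpha-\epsilon}_{p,q}$. For $q=\infty$ we have $L^{\alpha,p}\hookrightarrow B^{\alpha}_{p,\infty}$.
   Context: Setting: $(X,d,m)$ is a metric space with a Borel measure $m$ such that $m(X)=\infty$ and, for some $N>0$ (Ahlfors $N$-regularity), $c^{-1}r^N\le m(B(x,r))\le c\,r^N$ for all $x\in X$, $r>0$, with $c$ independent of $x,r$. Approximation of the identity: fix a non-negative decreasing $C^\infty$ function $h:[0,\infty)\to\mathbb{R}$ with $h\equiv1$ on $[0,1/2]$ and $h\equiv0$ on $[2,\infty)$. For $t>0$ let $T_tf(x)=t^{-N}\int_X h(d(x,y)/t)f(y)\,dm(y)$, $\varphi(x,t)=1/T_t1(x)$, $\psi(x,t)=1/T_t\left(\frac{1}{T_t1}\right)(x)$, and $$s(x,y,t)=\frac{\varphi(x,t)\varphi(y,t)}{t^{2N}}\int_X h\left(\tfrac{d(x,z)}{t}\right)h\left(\tfrac{d(y,z)}{t}\right)\psi(z,t)\,dm(z).$$ Bessel potential: for $\alpha>0$, $k_\alpha(x,y)=\alpha\int_0^\infty\frac{t^\alpha}{(1+t^\alpha)^2}s(x,y,t)\frac{dt}{t}$ and $J_\alpha g(x)=\int_X g(z)k_\alpha(x,z)\,dm(z)$; $J_\alpha$ is a contraction on $L^p$, $1\le p\le\infty$. Potential space: $L^{\alpha,p}=J_\alpha(L^p)$ with norm $\|f\|_{\alpha,p}=\|f\|_p+\inf\{\|g\|_p: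 g\in L^p,\ J_\alpha g=f\}$. Besov spaces: for $1\le p<\infty$, $t>0$, $E_pf(t)=\left(\int_X\frac{1}{m(B(x,t))}\int_{B(x,t)}|f(x)-f(y)|^p\,dm(y)\,dm(x)\right)^{1/p}$, and $E_\infty f(t)=\operatorname{ess\,sup}_{d(x,y)<t}|f(x)-f(y)|$. For $\alpha>0$, $1\le q<\infty$, $B^\alpha_{p,q}$ is the space of functions with finite norm $\|f\|_p+\left(\int_0^\infty t^{-\alpha q}E_pf(t)^q\frac{dt}{t}\right)^{1/q}$; for $q=\infty$ the norm is $\|f\|_p+\sup_{t>0}t^{-\alpha}E_pf(t)$. $A\hookrightarrow B$ means $A\subset B$ with continuous inclusion. *)

(* Defs.v *)
From HB Require Import structures.
From mathcomp Require Import all_boot all_order all_algebra.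
From mathcomp Require Import all_classical all_reals all_analysis.

Set Implicit Arguments.
Unset Strict Implicit.
Unset Printing Implicit Defensive.

Import Order.TTheory GRing.Theory Num.Theory.
Import numFieldNormedType.Exports.

Local Open Scope classical_set_scope.
Local Open Scope ring_scope.

HB.mixin Record isBorel d (R : numDomainType) T
    & Metric R T & Measurable d T := {
  borel_measurableE : (measurable : set (set T)) = <<s (open : set (set T)) >>
}.

#[short(type="borelMetricType")]
HB.structure Definition BorelMetric d (R : numDomainType) :=
  { T of Metric R T & Measurable d T & isBorel d R T }.

Section potential_besov.
Context {R : realType} {d : measure_display} {X : borelMetricType d R}.
Variable m : {measure set X -> \bar R}.

Definition ahlfors_regular (N : R) :=
  exists2 c : R, 0 < c & forall (x : X) (r : R), 0 < r ->
    ((c^-1 * r `^ N)%:E <= m (ball x r) <= (c * r `^ N)%:E)%E.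

(* h is a function on [0, +oo[; its values on negative reals are irrelevant.
   Smoothness at the endpoint 0 follows from h = 1 on [0, 1/2], so two-sided
   derivatives on ]0, +oo[ are all that is needed. *)
Definition cutoff (h : R -> R) :=
  [/\ forall x, 0 <= x -> 0 <= h x,
      forall x y, 0 <= x -> x <= y -> h y <= h x,
      forall (n : nat) x, 0 < x -> derivable (derive1n n h) x 1,
      forall x, 0 <= x <= 2^-1 -> h x = 1 &
      forall x, 2 <= x -> h x = 0].

Section bessel_potential.
Variables (N : R) (h : R -> R).

Definition averaging (t : R) (f : X -> R) (x : X) : R :=
  t `^ (- N) * \int[m]_y (h (mdist x y / t) * f y).

Definition phi (t : R) (x : X) : R := (averaging t (cst 1) x)^-1.

Definition psi (t : R) (x : X) : R := (averaging t (phi t) x)^-1.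

Definition approx_kernel (t : R) (x y : X) : R :=
  phi t x * phi t y / t `^ (2 * N) *
  \int[m]_z (h (mdist x z / t) * h (mdist y z / t) * psi t z).

(* Extended-real valued: the kernel may be infinite on the diagonal. *)
Definition bessel_kernel (a : R) (x y : X) : \bar R :=
  (a%:E * \int[lebesgue_measure]_(t in `]0%R, +oo[)
     (t `^ a / (1 + t `^ a) ^+ 2 * approx_kernel t x y / t)%:E)%E.

Definition bessel_potential (a : R) (g : X -> R) (x : X) : \bar R :=
  (\int[m]_z ((g z)%:E * bessel_kernel a x z))%E.

(* [J_a g = f] in L^p.  As f is real valued, this also says that the integral
   defining [J_a g x] converges absolutely for almost every x. *)
Definition is_potential (a : R) (g f : X -> R) :=
  {ae m, forall x, bessel_potential a g x = (f x)%:E}.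

(* Elements of function spaces are represented by measurable functions. *)
Definition potential_space (a : R) (p : \bar R) : set (X -> R) :=
  [set f | measurable_fun setT f /\
           exists2 g, g \in Lfun m p & is_potential a g f].

Definition potential_norm (a : R) (p : \bar R) (f : X -> R) : \bar R :=
  ('N[m]_p [EFin \o f] +
   ereal_inf [set 'N[m]_p [EFin \o g] |
              g in [set g | g \in Lfun m p /\ is_potential a g f]])%E.

End bessel_potential.

(* The case p = +oo is the essential supremum over the pairs (x, y) with
   d(x, y) < t; p = -oo is a junk case. *)
Definition modulus (p : \bar R) (f : X -> R) (t : R) : \bar R :=
  match p with
  | p%:E =>
      (\int[m]_x ((fine (m (ball x t)))^-1%:E *
         \int[m]_(y in ball x t) (`|f x - f y| `^ p)%:E)) `^ p^-1
  | _ =>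
      ereal_inf [set y : \bar R | {ae (m \x m), forall z : X * X,
        (mdist z.1 z.2 < t)%R -> (`|f z.1 - f z.2|)%:E <= y}]
  end%E.

Definition besov_norm (b : R) (p q : \bar R) (f : X -> R) : \bar R :=
  ('N[m]_p [EFin \o f] +
   match q with
   | q%:E =>
       (\int[lebesgue_measure]_(t in `]0%R, +oo[)
          ((t `^ (- (b * q)))%:E * modulus p f t `^ q * (t^-1)%:E)) `^ q^-1
   | _ =>
       ereal_sup [set (t `^ (- b))%:E * modulus p f t | t in `]0%R, +oo[]
   end)%E.

Definition besov_space (b : R) (p q : \bar R) : set (X -> R) :=
  [set f | measurable_fun setT f /\ (besov_norm b p q f < +oo)%E].

End potential_besov.

(* A is contained in B and the inclusion is continuous for the given norms. *)
Definition continuously_embedded {R : realType} {T : Type}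
    (A : set (T -> R)) (normA : (T -> R) -> \bar R)
    (B : set (T -> R)) (normB : (T -> R) -> \bar R) :=
  A `<=` B /\
  forall f, A f -> forall e : R, 0 < e -> exists2 r : R, 0 < r &
    forall g, A g -> (normA (g \- f)%R < r%:E)%E -> (normB (g \- f)%R < e%:E)%E.

(* Main.v *)
(* Write beta_{b,r}(u) = r^b u^b / ((r^b + u^b)^2 u), whose integral over
   ]0, +oo[ is at most 1/b.  The kernel of J_a is the integral of beta_{a,1}
   against the approximation kernels s(x, y, u), and these satisfy
   s(x, z, u) <= C u^-N 1[d(x, z) < 4u] and, when d(x, y) < t,
     |s(x, z, u) - s(y, z, u)|
       <= C min(1, t/u) u^-N (1[d(x, z) < 4u] + 1[d(y, z) < 4u]).
   For 0 < a < 1 the factor min(1, t/u) beta_{a,1}(u) is at most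
   4 t^a (beta_{a,t}(u) + beta_{1-a,t}(u)), so that f = J_a g satisfies
   |f x - f y| <= F x + F y almost everywhere on d(x, y) < t, where F is the
   integral of |g| against a symmetric radial kernel of mass O(t^a).  Schur's
   test gives |F|_p = O(t^a) |g|_p, hence E_p f(t) = O(min(1, t^a)) |g|_p, and
   both embeddings follow by taking the supremum, or the integral, over t. *)

(* The Bessel kernel takes values in [\bar R], may be infinite on the diagonal, and is integrated
   against a signed [g], so differences of kernels are never formed. Each regularity estimate is
   kept in the additive form k(x,z) <= k(y,z) + q(z), in both directions, and is integrated
   separately against the positive and negative parts of [g]; these integrals are finite because [f]
   is real valued. The restriction a < 1 enters at the scales u >= t: there the integrand is at most
   t u^(a-2), whose integral from t to infinity is of order t^a precisely because a - 1 is negative.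
   The truncated powers on both sides of t are replaced by members of one family with an elementary
   primitive, which serves again for the Besov integral in t. The bound by F x + F y separates the
   variables, so that finite p and p = +oo both reduce to the norm of a function of one variable. In
   min(1, t^a) the 1 makes the Besov integral converge at infinity and t^a handles 0; at the
   smoothness a itself the bound would leave dt/t near 0, whence the loss of [e] for finite [q]. *)
Require Import Defs.
From HB Require Import structures.
From mathcomp Require Import all_boot all_order all_algebra.
From mathcomp Require Import all_classical all_reals all_analysis.
From mathcomp Require Import measurable_realfun ess_sup_inf.
From mathcomp Require Import ring lra.

Set Implicit Arguments.
Unset Strict Implicit.
Unset Printing Implicit Defensive.

Import Order.TTheory GRing.Theory Num.Theory.
Import numFieldNormedType.Exports.

Local Open Scope classical_set_scope.
Local Open Scope ring_scope.

(** * Integrals of nonnegative functions and Schur's test *)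

(* The integral of a nonnegative function is a supremum over simple functions
   below it, so no measurability is needed. *)
Lemma ge0_le_integral_nomeas d (T : measurableType d) (R : realType)
    (mu : {measure set T -> \bar R}) (D : set T) (f g : T -> \bar R) :
  (forall x, D x -> 0 <= f x)%E -> (forall x, D x -> f x <= g x)%E ->
  (\int[mu]_(x in D) f x <= \int[mu]_(x in D) g x)%E.
Proof.
move=> f0 fg.
have g0 x : D x -> (0 <= g x)%E by move=> Dx; exact: le_trans (f0 _ Dx) (fg _ Dx).
rewrite !ge0_integralE//; apply: ge_ereal_sup => _ [h /= hf <-].
apply: ereal_sup_ubound; exists h => // x /=; apply: (le_trans (hf x)).
by apply: lee_restrict.
Qed.

(** Fubini-Tonelli is stated for the bundled type of sigma-finite measures, while the theorem takes
    a bare measure. An equality of measures lets the whole goal be rewritten. *)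
Lemma sigma_finite_measure_of d (T : measurableType d) (R : realType)
    (m : {measure set T -> \bar R}) :
  sigma_finite setT m -> exists m' : {sigma_finite_measure set T -> \bar R},
    m = m' :> {measure set T -> \bar R}.
Proof.
case: m => m [hm1 hm2] mfin.
pose m0 : {measure set T -> \bar R} := Measure.Pack (Measure.Class hm2).
pose hs := isSFinite.Build _ _ _ m (@sfinite_measure_sigma_finite _ _ _ m0 mfin).
pose hf := isSigmaFinite.Build _ _ _ m mfin.
pose m1 : {sigma_finite_measure set T -> \bar R} := HB.pack m hm1 hm2 hs hf.
by exists m1.
Qed.

(** Convexity: the graph of s^p lies above its tangent at [l]. This is Young's inequality for [s]
    and l^(p-1) with exponents [p] and [p / (p - 1)], multiplied by [p]; the case [p = 1], where the
    second exponent degenerates, is an equality. *)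
Lemma powR_tangent_le (R : realType) (p l s : R) : 1 <= p -> 0 <= l -> 0 <= s ->
  p * (l `^ (p - 1) * s) <= s `^ p + (p - 1) * l `^ p.
Proof.
rewrite le_eqVlt => /predU1P[<- l0 s0|p1 l0 s0].
  by rewrite subrr powRr0 powRr1// !mul1r mul0r addr0.
have p0 : 0 < p by lra.
have pm0 : 0 < p - 1 by lra.
have q0 : 0 < p / (p - 1) by rewrite divr_gt0.
have pq : p^-1 + (p / (p - 1))^-1 = 1 by field; rewrite !gt_eqF.
have := conjugate_powR s0 (powR_ge0 l (p - 1)) p0 q0 pq.
rewrite -powRrM [(p - 1) * _]mulrC divfK ?gt_eqF// => h.
rewrite -(ler_pM2l p0) in h; apply: le_trans (le_trans h _).
  by rewrite [s * _]mulrC.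
rewrite le_eqVlt; apply/orP; left; apply/eqP; field; rewrite !gt_eqF//.
Qed.

Section jensen.
Context d (T : measurableType d) (R : realType).
Variable mu : {measure set T -> \bar R}.
Local Open Scope ereal_scope.

(* Integrate the tangent inequality at [l = I / A], where [I] is the integral of
   [s * w]. *)
Lemma powR_integral_le (w : T -> \bar R) (s : T -> R) (A p : R) :
  (0 < A)%R -> (1 <= p)%R -> measurable_fun setT w -> measurable_fun setT s ->
  (forall x, 0 <= w x) -> (forall x, 0 <= s x)%R -> \int[mu]_x w x <= A%:E ->
  (\int[mu]_x ((s x)%:E * w x)) `^ p <=
  (A `^ (p - 1))%:E * \int[mu]_x ((s x `^ p)%:E * w x).
Proof.
move=> A0 p1 mw ms w0 s0 wA.
have p0 : (0 < p)%R by lra.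
have pm0 : (0 <= p - 1)%R by lra.
set I := \int[mu]_x ((s x)%:E * w x); set G := \int[mu]_x ((s x `^ p)%:E * w x).
have I0 : 0 <= I by apply: integral_ge0 => x _; rewrite mule_ge0 ?lee_fin.
have G0 : 0 <= G by apply: integral_ge0 => x _; rewrite mule_ge0 ?lee_fin ?powR_ge0.
have msp : measurable_fun setT (fun x => s x `^ p)%R.
  exact: (measurableT_comp (measurable_powR p) ms).
have tangent l : (0 <= l)%R ->
    (p * l `^ (p - 1))%:E * I <= G + ((p - 1) * l `^ p * A)%:E.
  move=> l0; rewrite -ge0_integralZl//; first last.
  - by rewrite lee_fin mulr_ge0 ?powR_ge0// ltW.
  - by move=> x _; rewrite mule_ge0 ?lee_fin.
  - by apply: emeasurable_funM => //; exact/measurable_EFinP.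
  apply: (@le_trans _ _ (\int[mu]_x ((s x `^ p)%:E * w x + ((p - 1) * l `^ p)%:E * w x))).
    apply: ge0_le_integral_nomeas => x _.
      by rewrite mule_ge0 ?mule_ge0 ?lee_fin ?mulr_ge0 ?powR_ge0// ltW.
    rewrite -ge0_muleDl ?lee_fin ?mulr_ge0 ?powR_ge0// muleA -EFinM -EFinD.
    by apply: lee_wpmul2r => //; rewrite lee_fin -mulrA powR_tangent_le.
  rewrite ge0_integralD//; first last.
  - by apply: emeasurable_funM.
  - by move=> x _; rewrite mule_ge0 ?lee_fin ?mulr_ge0 ?powR_ge0.
  - by apply: emeasurable_funM => //; exact/measurable_EFinP.
  - by move=> x _; rewrite mule_ge0 ?lee_fin ?powR_ge0.
  rewrite leeD2l// ge0_integralZl ?lee_fin ?mulr_ge0 ?powR_ge0//.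
  by rewrite [leRHS]EFinM; apply: lee_wpmul2l => //; rewrite lee_fin mulr_ge0 ?powR_ge0.
have Ap0 : (0 < A `^ (p - 1))%R by rewrite powR_gt0.
have [Gy|] := eqVneq G +oo.
  by rewrite Gy gt0_muley ?lte_fin// leey.
move=> Gfin; have {Gfin}Gfin : G \is a fin_num by rewrite ge0_fin_numE// ltey.
(* If [I] were infinite, the tangent inequality at 1 would make [G] plus a constant infinite,
   although [G] is finite. *)
have [Iy|Ifin] := eqVneq I +oo.
  have := tangent 1%R ler01; rewrite Iy gt0_muley; last by rewrite lte_fin powR1 mulr1.
  by rewrite -(fineK Gfin) -EFinD leye_eq.
have {}Ifin : I \is a fin_num by rewrite ge0_fin_numE// ltey.
have := tangent (fine I / A)%R; rewrite -(fineK Ifin) -(fineK Gfin) /=.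
have i0 : (0 <= fine I)%R by rewrite fine_ge0.
rewrite divr_ge0 ?(ltW A0)// => /(_ isT).
rewrite -EFinM -EFinD !lee_fin.
(* For l = I / A one has l^(p-1) I = l^p A, so the tangent inequality collapses to l^p A <= G, which
   is the claim after multiplication by A^(p-1). *)
have iAp : ((fine I / A) `^ (p - 1) * fine I = (fine I / A) `^ p * A)%R.
  have -> : ((fine I / A) `^ p = (fine I / A) `^ (p - 1) * (fine I / A))%R.
    have [->|i_neq0] := eqVneq (fine I) 0%R; first by rewrite mul0r powR0 ?gt_eqF// mulr0.
    rewrite -{1}(subrK 1%R p) [LHS]powRD ?powRr1// ?divr_ge0 ?(ltW A0)//.
    by apply/implyP => _; rewrite mulf_neq0 ?invr_eq0// gt_eqF.
  by rewrite -!mulrA mulVf ?mulr1// gt_eqF.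
rewrite -[leLHS]mulrA iAp => h.
have {}h : ((fine I / A) `^ p * A <= fine G)%R by nra.
rewrite powRM// ?invr_ge0 ?(ltW A0)// in h.
have AA : (A^-1 `^ p * A * A `^ (p - 1) = 1)%R.
  rewrite -powR_inv1 ?(ltW A0)// -powRrM mulN1r powRN -mulrA.
  rewrite -{2}(powRr1 (ltW A0)) -powRD; last by apply/implyP => _; rewrite gt_eqF.
  by rewrite addrC subrK mulVf// gt_eqF// powR_gt0.
rewrite -(ler_pM2l Ap0) in h; apply: le_trans h.
rewrite [leRHS](_ : _ = fine I `^ p * (A^-1 `^ p * A * A `^ (p - 1)))%R; last by ring.
by rewrite AA mulr1.
Qed.
End jensen.

Lemma le_poweR (R : realType) (p : R) (x y : \bar R) : (0 <= p)%R -> (0 <= x ->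
  x <= y -> x `^ p <= y `^ p)%E.
Proof.
move=> p0 x0 xy; apply: (gt0_ler_poweR p0) => //; rewrite in_itv/= leey andbT//.
exact: le_trans xy.
Qed.

Section schur.
Context d (T : measurableType d) (R : realType).
Variable mu : {sigma_finite_measure set T -> \bar R}.
Local Open Scope ereal_scope.

(** Jensen's inequality on each row, against the weight [K (x, _)] of mass at most [A], costs
    A^(p-1); after Tonelli the column bound costs one more [A], and the root turns A^p into [A]. For
    [p = +oo] the row bound is applied to the essential supremum of |g|. *)
Lemma schur_test (K : T * T -> \bar R) (A : R) (p : \bar R) (g : T -> R) :
  (0 < A)%R -> 1 <= p -> measurable_fun setT K -> (forall z, 0 <= K z) ->
  (forall x, \int[mu]_z K (x, z) <= A%:E) ->
  (forall z, \int[mu]_x K (x, z) <= A%:E) -> measurable_fun setT g ->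
  'N[mu]_p[(fun x => \int[mu]_z (`|g z|%:E * K (x, z)))] <=
  A%:E * 'N[mu]_p [EFin \o g].
Proof.
move=> A0 p1 mK K0 K1 K2 mg; set F := fun x => _.
have F0 x : 0 <= F x by apply: integral_ge0 => z _; rewrite mule_ge0.
have mng : measurable_fun setT (fun z => `|g z|%R) by exact: measurableT_comp.
rewrite unlock; case: p p1 => [p|_|//]; first rewrite lee_fin => p1.
  have p0 : (0 < p)%R by apply: lt_le_trans p1.
  have mgp : measurable_fun setT (fun z => `|g z| `^ p)%R.
    exact: (measurableT_comp (measurable_powR p) mng).
  have mKgp : measurable_fun setT (fun z : T * T => (`|g z.2| `^ p)%:E * K z).
    apply: emeasurable_funM => //; apply/measurable_EFinP.
    exact: (measurableT_comp mgp measurable_snd).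
  have FG : \int[mu]_x (`|F x| `^ p) <= (A `^ p)%:E * \int[mu]_x (`|(EFin \o g) x| `^ p).
    apply: (@le_trans _ _ (\int[mu]_x ((A `^ (p - 1))%:E *
        \int[mu]_z ((`|g z| `^ p)%:E * K (x, z))))).
      apply: ge0_le_integral_nomeas => x _; first exact: poweR_ge0.
      rewrite gee0_abs//; apply: powR_integral_le => //.
      exact: (measurableT_comp mK (measurable_pair1 x)).
    rewrite ge0_integralZl//; first last.
    - by rewrite lee_fin powR_ge0.
    - by move=> x _; apply: integral_ge0 => z _; rewrite mule_ge0 ?lee_fin ?powR_ge0.
    - apply: (measurable_fun_fubini_tonelli_F (fun z : T * T => (`|g z.2| `^ p)%:E * K z)) => //.
      by move=> z; rewrite mule_ge0 ?lee_fin ?powR_ge0.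
    rewrite (fubini_tonelli (fun z : T * T => (`|g z.2| `^ p)%:E * K z)) => [|//|]; last first.
      by move=> z; rewrite mule_ge0 ?lee_fin ?powR_ge0.
    have -> : (A `^ p = A `^ (p - 1) * A)%R.
      rewrite -{3}(powRr1 (ltW A0)) -powRD ?subrK//.
      by apply/implyP => _; rewrite gt_eqF.
    rewrite EFinM -muleA; apply: lee_wpmul2l; first by rewrite lee_fin powR_ge0.
    rewrite -ge0_integralZl//; first last.
    - by rewrite lee_fin ltW.
    - by move=> x _; rewrite poweR_ge0.
    - exact/measurable_EFinP.
    apply: ge0_le_integral_nomeas => z _.
      by apply: integral_ge0 => x _; rewrite mule_ge0 ?lee_fin ?powR_ge0.
    have -> : \int[mu]_x ((`|g z| `^ p)%:E * K (x, z)) =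
        (`|g z| `^ p)%:E * \int[mu]_x K (x, z).
      apply: ge0_integralZl; rewrite ?lee_fin ?powR_ge0//.
      exact: (measurableT_comp mK (measurable_pair2 z)).
    by rewrite muleC; apply: lee_wpmul2r; rewrite ?poweR_ge0.
  have := le_poweR _ _ FG => /(_ p^-1%R); rewrite invr_ge0 (ltW p0) => /(_ isT).
  rewrite integral_ge0 => [/(_ isT)|x _]; last exact: poweR_ge0.
  rewrite poweRM ?lee_fin ?powR_ge0//; last by apply: integral_ge0 => x _; rewrite poweR_ge0.
  by rewrite poweR_EFin -powRrM divff ?gt_eqF// powRr1// ltW.
(* On a space of measure zero the norm for [p = +oo] is 0 by definition. *)
case: ifPn => m0; last by rewrite mule0.
set M := ess_sup mu (abse \o (EFin \o g)).
have M0 : 0 <= M by apply: ess_sup_gee => //; apply: nearW => x /=.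
apply/ess_supP; apply: nearW => x /=; rewrite gee0_abs//.
apply: (@le_trans _ _ (\int[mu]_z (M * K (x, z)))).
  have mKx : measurable_fun setT (fun z => K (x, z)).
    exact: (measurableT_comp mK (measurable_pair1 x)).
  apply: ae_ge0_le_integral => //.
  - by move=> z _; rewrite mule_ge0.
  - by apply: emeasurable_funM => //; exact/measurable_EFinP.
  - by move=> z _; rewrite mule_ge0.
  - by apply: emeasurable_funM.
  - apply: filterS (ess_sup_ge mu (abse \o (EFin \o g))) => z /= gM _.
    exact: lee_wpmul2r.
have -> : \int[mu]_z (M * K (x, z)) = M * \int[mu]_z K (x, z).
  apply: ge0_integralZl => //.
  exact: (measurableT_comp mK (measurable_pair1 x)).
by rewrite muleC; apply: lee_wpmul2r.
Qed.
End schur.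

(** * The weights *)

(** The power with exponent -1 is measurable and agrees with the inverse for [0 <= x], including 0,
    where both are 0; oddness gives the negative reals. *)
Lemma measurable_invr (R : realType) : measurable_fun setT (@GRing.inv R).
Proof.
have -> : @GRing.inv R = fun x => if 0 <= x then x `^ (-1) else - (- x) `^ (-1).
  apply/funext => x; case: (leP 0 x) => x0; rewrite powR_inv1//.
    by rewrite invrN opprK.
  by rewrite oppr_ge0 ltW.
apply: measurable_fun_ifT; first exact: measurable_fun_ler.
  exact: measurable_powR.
apply: measurableT_comp => //.
exact: (measurableT_comp (measurable_powR (-1))).
Qed.

Lemma measurable_funV d (T : measurableType d) (R : realType) (f : T -> R) :
  measurable_fun setT f -> measurable_fun setT (fun x => (f x)^-1).
Proof. exact: measurableT_comp (@measurable_invr R). Qed.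

Section weights.
Context {R : realType}.
Implicit Types b r u : R.

(* [u |-> u `^ b / (b * (r `^ b + u `^ b))] is an antiderivative. *)
Definition weight b r u : R := r `^ b * u `^ b / (r `^ b + u `^ b) ^+ 2 / u.

Lemma weight_ge0 b r u : 0 <= u -> 0 <= weight b r u.
Proof. by move=> u0; rewrite !mulr_ge0 ?invr_ge0 ?exprn_ge0 ?addr_ge0 ?powR_ge0. Qed.

Lemma measurable_weight b r : measurable_fun setT (weight b r).
Proof.
have mb := measurable_powR b.
apply: measurable_funM; last exact: measurable_invr.
apply: measurable_funM; first exact: measurable_funM.
by apply: measurable_funV; apply: measurable_funX; exact: measurable_funD.
Qed.

Lemma powR_divr b u : 0 < u -> u `^ b / u = u `^ (b - 1).
Proof.
move=> u0; rewrite powRB ?powRr1 ?(ltW u0)//.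
by apply/implyP => _; rewrite gt_eqF.
Qed.

(** This primitive differs from the one named at [weight] by the constant 1/b; its values lie in
    [-1/b, 0], from which the bound 1/b on every integral is read off. *)
Lemma is_derive_weight b r u : b != 0 -> 0 < r -> 0 < u ->
  is_derive u 1 ((- (r `^ b / b)) \*: (fun v => (r `^ b + v `^ b)^-1)) (weight b r u).
Proof.
move=> b0 r0 u0.
have rb0 : 0 < r `^ b by rewrite powR_gt0.
have ub0 : 0 < u `^ b by rewrite powR_gt0.
have d1 : is_derive u 1 (cst (r `^ b) + (@powR R ^~ b)) (0 + b * u `^ (b - 1)).
  by apply: is_deriveD; exact: is_derive1_powR.
have nz : (cst (r `^ b) + (@powR R ^~ b)) u != 0 by rewrite gt_eqF// addr_gt0.
have d2 := is_deriveZ (- (r `^ b / b)) (is_deriveV nz d1).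
apply: (is_derive_eq d2).
rewrite /weight -powR_divr// add0r /GRing.scale /=.
rewrite -[(cst _ + _) u]/(r `^ b + u `^ b).
by field; rewrite b0 !gt_eqF// addr_gt0.
Qed.

Lemma derivable_weight b r u : 0 < r -> 0 < u -> derivable (weight b r) u 1.
Proof.
move=> r0 u0.
have rb0 : 0 < r `^ b by rewrite powR_gt0.
have ub0 : 0 < u `^ b by rewrite powR_gt0.
have dp := is_derive1_powR b u0.
have dn := is_deriveM (is_derive_cst (r `^ b) u 1) dp.
have ds := is_deriveD (is_derive_cst (r `^ b) u 1) dp.
have dd := is_deriveM ds ds.
have nz : ((cst (r `^ b) + (@powR R ^~ b)) * (cst (r `^ b) + (@powR R ^~ b))) u != 0.
  by rewrite gt_eqF// mulr_gt0// addr_gt0.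
have di := is_deriveV nz dd.
have du := is_deriveV (lt0r_neq0 u0) (is_derive_id u 1).
exact: (@ex_derive _ _ _ _ _ _ _ (is_deriveM (is_deriveM dn di) du)).
Qed.

Lemma integral_weight_le b r : 0 < b -> 0 < r ->
  (\int[lebesgue_measure]_(u in `]0%R, +oo[) (weight b r u)%:E <= (b^-1)%:E)%E.
Proof.
move=> b0 r0.
have rb0 : 0 < r `^ b by rewrite powR_gt0.
(* Compact intervals exhausting ]0, +oo[, for monotone convergence. The shift by 2 keeps the first
   one nondegenerate, as the fundamental theorem of calculus requires; an integer above u + 1/u is
   an index whose interval contains u. *)
pose F n : set R := `[n.+2%:R^-1, n.+2%:R]%classic.
have F0 n u : F n u -> 0 < u.
  by rewrite /F/= in_itv/= => /andP[+ _]; apply: lt_le_trans; rewrite invr_gt0.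
have UF : \bigcup_n F n = `]0%R, +oo[%classic.
  apply/seteqP; split => [u [n _ /F0]|u]; rewrite /= in_itv/= andbT// => u0.
  exists (Num.truncn (u + u^-1)) => //; rewrite /F/= in_itv/=.
  have h : u + u^-1 < (Num.truncn (u + u^-1)).+2%:R.
    rewrite (lt_trans (truncnS_gt _))// ltr_nat//.
  have ui0 : 0 < u^-1 by rewrite invr_gt0.
  apply/andP; split; last by apply: ltW; apply: lt_trans h; rewrite ltrDl.
  rewrite -[leRHS]invrK lef_pV2 ?posrE ?ltr0n//.
  by apply: ltW; apply: lt_trans h; rewrite ltrDr.
have ndF : nondecreasing_seq F.
  move=> n k nk; apply/subsetPset => u; rewrite /F/= !in_itv/= => /andP[nu un].
  have hnk : n.+2%:R <= k.+2%:R :> R by rewrite ler_nat.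
  by rewrite (le_trans _ nu) ?(le_trans un)// lef_pV2 ?posrE ?ltr0n.
have cont n : {within F n, continuous (weight b r)}.
  apply: derivable_within_continuous => u uF; apply: derivable_weight => //.
  exact: (F0 n).
have := @ge0_nondecreasing_set_cvg_integral _ (measurableTypeR R) R F (EFin \o weight b r) lebesgue_measure ndF.
rewrite UF => cvgF; apply: cvge_le (cvgF _ _ _); last 3 first.
- by move=> n; exact: measurable_itv.
- move=> n; apply/measurable_EFinP; apply: subspace_continuous_measurable_fun => //.
  exact: measurable_itv.
- by move=> n u /F0 u0 /=; rewrite lee_fin weight_ge0// ltW.
apply: nearW => n.
have n1 : n.+2%:R^-1 < n.+2%:R :> R.
  by rewrite (@lt_trans _ _ 1)// ?invf_lt1 ?ltr0n// ltr1n.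
pose G := (- (r `^ b / b)) \*: (fun v => (r `^ b + v `^ b)^-1).
have dG u : 0 < u -> is_derive u 1 G (weight b r u).
  by move=> u0; apply: is_derive_weight => //; rewrite gt_eqF.
have cG u : 0 < u -> G x @[x --> u] --> G u.
  move=> /dG[+ _] => /derivable1_diffP/differentiable_continuous; exact.
have n0 : 0 < n.+2%:R^-1 :> R by rewrite invr_gt0 ltr0n.
rewrite /F (@continuous_FTC2 _ _ G)//.
- have Gub u : 0 < u -> - b^-1 <= G u <= 0.
    move=> u0; have ub0 : 0 < u `^ b by rewrite powR_gt0.
    rewrite /G /= /GRing.scale /= mulNr oppr_le0 lerN2; apply/andP; split; last first.
      by rewrite !mulr_ge0 ?invr_ge0 ?powR_ge0 ?addr_ge0 ?powR_ge0// ltW.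
    rewrite mulrAC -[leRHS]mul1r ler_pM2r ?invr_gt0//.
    by rewrite ler_pdivrMr ?addr_gt0// mul1r lerDl ltW.
  rewrite -EFinB lee_fin.
  have /andP[h1 _] := Gub _ n0; have /andP[_ h2] := Gub n.+2%:R (ltr0Sn _ _).
  by lra.
- exact: cont.
- split.
  + move=> u; rewrite in_itv/= => /andP[nu _].
    by have [] := dG u (lt_trans n0 nu).
  + by apply: cvg_at_right_filter; exact: cG.
  + by apply: cvg_at_left_filter; apply: cG; rewrite ltr0Sn.
- move=> u; rewrite in_itv/= => /andP[nu _].
  have [_] := dG u (lt_trans n0 nu).
  by rewrite derive1E.
Qed.

(* [weight a r] dominates on ]0, r] and [weight (1 - a) r] on [r, +oo[. *)
Definition split_weight a r u : R := 4 * r `^ a * (weight a r u + weight (1 - a) r u).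

Lemma split_weight_ge0 a r u : 0 <= u -> 0 <= split_weight a r u.
Proof. by move=> u0; rewrite !mulr_ge0 ?addr_ge0 ?weight_ge0 ?powR_ge0. Qed.

Lemma measurable_split_weight a r : measurable_fun setT (split_weight a r).
Proof.
apply: measurable_funM => //.
by apply: measurable_funD; exact: measurable_weight.
Qed.

(** For u <= r the denominator (r^b + u^b)^2 is at most 4 r^(2b). This, with its mirror image for r
    <= u, is the origin of the factor 4 in [split_weight]. *)
Lemma weight_le_l b r u : 0 < b -> 0 < u -> u <= r ->
  u `^ b / u <= 4 * r `^ b * weight b r u.
Proof.
move=> b0 u0 ur; have r0 := lt_le_trans u0 ur.
have ub0 : 0 < u `^ b by rewrite powR_gt0.
have rb0 : 0 < r `^ b by rewrite powR_gt0.
have : u `^ b <= r `^ b by rewrite ge0_ler_powR ?nnegrE ?(ltW b0) ?(ltW u0) ?(ltW r0).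
rewrite /weight; move: (u `^ b) (r `^ b) ub0 rb0 => p q p0 q0 pq.
rewrite mulrA ler_pM2r ?invr_gt0// mulrA ler_pdivlMr ?exprn_gt0 ?addr_gt0//.
rewrite [leRHS](_ : _ = p * (4 * q ^+ 2)); last by ring.
by rewrite ler_pM2l//; nra.
Qed.

Lemma weight_le_r b r u : 0 < b -> 0 < r -> r <= u ->
  r `^ b / u `^ b / u <= 4 * weight b r u.
Proof.
move=> b0 r0 ru; have u0 := lt_le_trans r0 ru.
have ub0 : 0 < u `^ b by rewrite powR_gt0.
have rb0 : 0 < r `^ b by rewrite powR_gt0.
have : r `^ b <= u `^ b by rewrite ge0_ler_powR ?nnegrE ?(ltW b0) ?(ltW u0) ?(ltW r0).
rewrite /weight; move: (u `^ b) (r `^ b) ub0 rb0 => p q p0 q0 pq.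
rewrite mulrA ler_pM2r ?invr_gt0// mulrA ler_pdivlMr ?exprn_gt0 ?addr_gt0//.
rewrite [leLHS](_ : _ = (q / p) * (q + p) ^+ 2); last by rewrite mulrAC.
rewrite [leRHS](_ : _ = (q / p) * (4 * p ^+ 2)); last by field; rewrite gt_eqF.
by rewrite ler_pM2l ?divr_gt0//; nra.
Qed.

Lemma weight1_le b u : 0 < u -> weight b 1 u <= u `^ b / u.
Proof.
move=> u0; have ub0 := powR_ge0 u b.
rewrite /weight powR1 mul1r ler_pM2r ?invr_gt0// ler_pdivrMr.
  by rewrite ler_peMr// expr_ge1 ?addr_ge0// lerDl.
by rewrite exprn_gt0// ltr_pwDl.
Qed.

(** For u <= r the bound u^(a-1) is compared with [weight a r]. For r <= u, rewriting u^(a-1) (r/u)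
    as r^a (r/u)^(1-a) / u brings in the exponent 1 - a, positive since a < 1, and
    [weight (1 - a) r] takes over. *)
Lemma weight_min_le a r u : 0 < a < 1 -> 0 < r -> 0 < u ->
  weight a 1 u * Num.min 1 (r / u) <= split_weight a r u.
Proof.
move=> /andP[a0 a1] r0 u0; have a10 : 0 < 1 - a by rewrite subr_gt0.
have ub1 := weight_ge0 a r (ltW u0); have ub2 := weight_ge0 (1 - a) r (ltW u0).
have rb := powR_ge0 r a.
have [ru|ru] := leP 1 (r / u).
  rewrite mulr1; apply: (le_trans (weight1_le a u0)).
  have ur : u <= r by move: ru; rewrite ler_pdivlMr// mul1r.
  apply: (le_trans (weight_le_l a0 u0 ur)).
  by rewrite /split_weight ler_wpM2l ?lerDl// mulr_ge0.
have {}ru : r <= u by move: ru; rewrite ltr_pdivrMr// mul1r => /ltW.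
apply: (@le_trans _ _ (u `^ a / u * (r / u))).
  by rewrite ler_wpM2r ?weight1_le// divr_ge0// ltW.
have := weight_le_r a10 r0 ru.
have ua : 0 < u `^ a by rewrite powR_gt0.
have ra : 0 < r `^ a by rewrite powR_gt0.
have powB v : 0 < v -> v `^ (1 - a) = v / v `^ a.
  move=> v0; rewrite powRB ?powRr1// ?(ltW v0)//.
  by apply/implyP => _; rewrite gt_eqF.
rewrite !powB// => h.
apply: (@le_trans _ _ (r `^ a * (4 * weight (1 - a) r u))); last first.
  rewrite mulrCA [leLHS]mulrA /split_weight; apply: ler_wpM2l; first exact: mulr_ge0.
  by rewrite lerDr.
rewrite [leLHS](_ : _ = r `^ a * (r / r `^ a / (u / u `^ a) / u)).
  by rewrite ler_pM2l.
by field; rewrite !gt_eqF.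
Qed.

Lemma integral_weightD_le b1 b2 r : 0 < b1 -> 0 < b2 -> 0 < r ->
  (\int[lebesgue_measure]_(u in `]0%R, +oo[) (weight b1 r u + weight b2 r u)%:E
   <= (b1^-1 + b2^-1)%:E)%E.
Proof.
move=> b10 b20 r0.
have pos b (u : R) : `]0, +oo[%classic u -> (0 <= (weight b r u)%:E)%E.
  by rewrite /= in_itv/= andbT => /ltW u0; rewrite lee_fin weight_ge0.
have meas b : measurable_fun (`]0%R, +oo[%classic : set (measurableTypeR R)) (EFin \o weight b r).
  by apply: measurable_funTS; apply/measurable_EFinP; exact: measurable_weight.
under eq_integral do rewrite EFinD.
rewrite ge0_integralD//; try exact: pos; try exact: meas.
by rewrite EFinD; apply: leeD; exact: integral_weight_le.
Qed.

Lemma integral_split_weight_le a r : 0 < a < 1 -> 0 < r ->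
  (\int[lebesgue_measure]_(u in `]0%R, +oo[) (split_weight a r u)%:E <=
   (4 * r `^ a * (a^-1 + (1 - a)^-1))%:E)%E.
Proof.
move=> /andP[a0 a1] r0; have a10 : 0 < 1 - a by rewrite subr_gt0.
have k0 : (0 <= (4 * r `^ a)%:E)%E by rewrite lee_fin mulr_ge0 ?powR_ge0.
rewrite /split_weight; under eq_integral do rewrite EFinM.
rewrite ge0_integralZl//; first last.
- move=> u; rewrite /= in_itv/= andbT => /ltW u0.
  by rewrite lee_fin addr_ge0// weight_ge0.
- apply: measurable_funTS; apply/measurable_EFinP.
  by apply: measurable_funD; exact: measurable_weight.
by rewrite [leRHS]EFinM; apply: lee_wpmul2l => //; exact: integral_weightD_le.
Qed.
End weights.

(** * Ahlfors regular spaces *)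

Section ahlfors.
Context {R : realType} d (X : borelMetricType d R).
Implicit Types (x y z : X) (r t : R).

Lemma mem_ball x y r : ball x r y = (mdist x y < r) :> Prop.
Proof. by rewrite ballEmdist. Qed.

Lemma ball_open_metric x r : open (ball x r).
Proof.
rewrite openE => y; rewrite mem_ball => xyr; apply/nbhs_ballP.
exists (r - mdist x y); first by rewrite /= subr_gt0.
move=> z; rewrite !mem_ball => yz.
by rewrite (le_lt_trans (metric_triangle _ y _))// -ltrBrDl.
Qed.

Lemma measurable_ball_metric x r : measurable (ball x r).
Proof.
by rewrite borel_measurableE; apply: sub_sigma_algebra; exact: ball_open_metric.
Qed.

Variables (m : {measure set X -> \bar R}) (N : R).
Hypothesis m_regular : ahlfors_regular m N.

Lemma ball_lty x r : (m (ball x r) < +oo)%E.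
Proof.
have [c c0 mb] := m_regular.
apply: (@le_lt_trans _ _ (m (ball x (`|r| + 1)))).
  apply: le_measure; rewrite ?inE; try exact: measurable_ball_metric.
  by apply: le_ball; rewrite (le_trans (ler_norm r))// lerDl.
have r0 : 0 < `|r| + 1 by rewrite ltr_wpDl.
by have /andP[_ /le_lt_trans] := mb x _ r0; apply; rewrite ltry.
Qed.

Lemma sigma_finite_ahlfors : sigma_finite setT m.
Proof.
have [->|/set0P[x0 _]] := eqVneq [set: X] set0.
  by exists (fun=> set0) => [|i]; rewrite ?bigcup_const// measure0.
exists (fun n => ball x0 n%:R).
  apply/seteqP; split => // y _; exists (Num.truncn (mdist x0 y)).+1 => //.
  by rewrite mem_ball truncnS_gt.
by move=> n; split; [exact: measurable_ball_metric|exact: ball_lty].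
Qed.

(** Balls of half the separation are disjoint, so their measures add up; this limits how many
    separated points fit in a ball of finite measure. *)
Lemma separated_measure_le r v (s : seq X) : 0 < r ->
  (forall x, (v%:E <= m (ball x (r / 2)))%E) ->
  pairwise (fun x y => r <= mdist x y) s ->
  (((size s)%:R * v)%:E <= m (\big[setU/set0]_(y <- s) ball y (r / 2)))%E.
Proof.
move=> r0 mv; elim: s => [_|y s IH /=]; first by rewrite mul0r big_nil measure0.
move=> /andP[/allP ys /IH{}IH]; rewrite big_cons measureU.
- rewrite -natr1 mulrDl mul1r addrC EFinD; apply: leeD; first exact: mv. exact: IH.
- exact: measurable_ball_metric.
- by apply: bigsetU_measurable => z _; exact: measurable_ball_metric.
apply/seteqP; split => // u []; rewrite mem_ball => yu.
rewrite -bigcup_seq => -[z /= /ys yz]; rewrite mem_ball => zu.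
have := metric_triangle y u z; rewrite [mdist u z]metric_sym; lra.
Qed.

(** Packing argument: without a finite net, points of the ball can be chosen greedily to form
    arbitrarily long [r]-separated sequences. Their half-radius balls have measure at least [v] each
    and lie in the ball of radius [k + r], whose measure is finite. *)
Lemma finite_net x0 k r : 0 < r -> exists s : seq X,
  ball x0 k `<=` \big[setU/set0]_(y <- s) ball y r.
Proof.
move=> r0; apply: contrapT => /forallNP nonet.
have r20 : 0 < r / 2 by rewrite divr_gt0.
have [c c0 mb] := m_regular.
pose v := c^-1 * (r / 2) `^ N.
have v0 : 0 < v by rewrite mulr_gt0 ?invr_gt0 ?powR_gt0.
have mv x : (v%:E <= m (ball x (r / 2)))%E by have /andP[] := mb x _ r20.
have sep n : exists s : seq X, [/\ size s = n,
    pairwise (fun x y => r <= mdist x y) s & {in s, forall y, ball x0 k y}].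
  elim: n => [|n [s [sn sr sk]]]; first by exists [::].
  have /existsNP[y /not_implyP[ky ny]] := nonet s.
  exists (y :: s); split => /=; [by rewrite sn| |].
    rewrite sr andbT; apply/allP => z zs; rewrite leNgt; apply/negP => yz.
    apply: ny; rewrite -bigcup_seq; exists z => //.
    by rewrite mem_ball metric_sym.
  by move=> z; rewrite in_cons => /predU1P[->|/sk].
pose M := fine (m (ball x0 (k + r))).
(* One point more than the total mass [M] can accommodate. *)
have [s [sn sr sk]] := sep (Num.truncn (M / v)).+1.
have : (((size s)%:R * v)%:E <= M%:E)%E.
  apply: (le_trans (separated_measure_le r0 mv sr)).
  rewrite fineK ?ge0_fin_numE ?ball_lty//; apply: le_measure; rewrite ?inE.
  - by apply: bigsetU_measurable => z _; exact: measurable_ball_metric.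
  - exact: measurable_ball_metric.
  rewrite -bigcup_seq => u [z /= /sk]; rewrite !mem_ball => zk zu.
  by rewrite (le_lt_trans (metric_triangle _ z _))//; lra.
rewrite lee_fin sn -ler_pdivlMr// leNgt => /negP; apply; exact: truncnS_gt.
Qed.

(* Ahlfors balls are totally bounded, so {d < a} is a countable union of
   rectangles; without separability the metric need not be measurable for the
   product sigma-algebra. *)
Lemma measurable_mdist : measurable_fun setT (fun z : X * X => mdist z.1 z.2).
Proof.
have [X0|/set0P[x0 _]] := eqVneq [set: X] set0.
  move=> _ Y mY; rewrite (_ : _ `&` _ = set0)//.
  by apply/seteqP; split => // -[x y] _; have : [set: X] x by []; rewrite X0.
pose e n : R := n.+1%:R^-1.
have e0 n : 0 < e n by rewrite invr_gt0.
have net n k : {s : seq X | ball x0 k%:R `<=` \big[setU/set0]_(y <- s) ball y (e n)}.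
  by apply: cid; apply: finite_net.
apply: (measurability _ (RGenInftyO.measurableE R)).
move=> _ [_ [a ->] <-]; rewrite setTI.
(* If 2 e_n < a - d(x,y) and [q] is a net point within e_n of [x], then d(q,y) < e_n + d(x,y) < a -
   e_n, so (x,y) lies in the rectangle at [q]. Conversely, on each rectangle the triangle inequality
   gives d(x,y) < a. The index [k] selects a ball around [x0] containing [x]. *)
have -> : (fun z : X * X => mdist z.1 z.2) @^-1` `]-oo, a[%classic =
    \bigcup_n \bigcup_k \big[setU/set0]_(q <- sval (net n k))
      (ball q (e n) `*` ball q (a - e n)).
  apply/seteqP; split => [[x y]|[x y] [n _ [k _]]] /=.
    rewrite in_itv/= => xya.
    pose n := Num.truncn (2 / (a - mdist x y)).
    have en : e n * 2 < a - mdist x y.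
      rewrite /e mulrC ltr_pdivrMr// -ltr_pdivrMl ?subr_gt0// mulrC.
      exact: truncnS_gt.
    exists n => //; exists (Num.truncn (mdist x0 x)).+1 => //.
    have := svalP (net n (Num.truncn (mdist x0 x)).+1).
    move=> /(_ x); rewrite mem_ball truncnS_gt => /(_ isT).
    rewrite -!bigcup_seq => -[q qs qx]; exists q => //; split => //=.
    move: qx; rewrite !mem_ball => qx.
    by rewrite (le_lt_trans (metric_triangle _ x _))//; lra.
  rewrite -bigcup_seq => -[q _ [/=]]; rewrite !mem_ball in_itv/= => qx qy.
  by rewrite (le_lt_trans (metric_triangle _ q _))// metric_sym; lra.
apply: bigcupT_measurable => n; apply: bigcupT_measurable => k.
apply: bigsetU_measurable => q _.
by apply: measurableX; exact: measurable_ball_metric.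
Qed.
End ahlfors.

(** [h] is arbitrary on the negative reals, so it is composed with the clamp onto [1/2, 2]. Nothing
    changes on [0, +oo[, where [h] is constant on either side of that interval, and on the interval
    itself the mean value theorem applies with the extrema of the continuous derivative. The summand
    1 in [L] makes it positive. *)
Lemma cutoff_lipschitz (R : realType) (h : R -> R) : cutoff h ->
  exists (H : R -> R) (L : R), [/\ 0 < L, forall x, 0 <= x -> h x = H x,
    forall x, 0 <= H x <= 1, forall x, 2 <= x -> H x = 0 &
    (forall x, x <= 2^-1 -> H x = 1) /\
    forall x y, `|H x - H y| <= L * `|x - y|].
Proof.
move=> [h0 hdec hd h1 h2].
pose cl (x : R) := Num.min (Num.max x 2^-1) 2.
have h12 : 2^-1 < 2 :> R by lra.
have cl_itv x : 2^-1 <= cl x <= 2 by rewrite /cl le_min ge_min le_max !lexx orbT ltW//= orbT.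
have dh x : 0 < x -> derivable h x 1 by exact: (hd 0%N).
have ch' : {within `[2^-1, 2], continuous (derive1 h)}.
  apply: derivable_within_continuous => x; rewrite in_itv/= => /andP[x0 _].
  by apply: (hd 1%N); apply: lt_le_trans x0.
have [cM _ hM] := EVT_max (ltW h12) ch'.
have [cm _ hm] := EVT_min (ltW h12) ch'.
pose L := 1 + `|derive1 h cM| + `|derive1 h cm|.
have L0 : 0 < L by rewrite /L ltr_wpDr// ltr_wpDr.
have hL x : 2^-1 <= x <= 2 -> `|derive1 h x| <= L.
  move=> xI; rewrite ler_norml.
  have := hM x; have := hm x; rewrite in_itv/= xI => /(_ isT) A /(_ isT) B.
  have := ler_norm (derive1 h cM); have := ler_norm (- derive1 h cm).
  rewrite normrN => C D; have := normr_ge0 (derive1 h cM); have := normr_ge0 (derive1 h cm).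
  by rewrite /L; lra.
have lip x y : 2^-1 <= x -> x <= y -> y <= 2 -> `|h y - h x| <= L * (y - x).
  move=> x0; rewrite le_eqVlt => /predU1P[->|xy y2]; first by rewrite !subrr normr0 mulr0.
  have [||c] := @MVT _ h (derive1 h) x y xy.
  - move=> c; rewrite in_itv/= => /andP[xc _]; rewrite derive1E; apply: DeriveDef => //.
    by apply: dh; lra.
  - by apply: derivable_within_continuous => c; rewrite in_itv/= => /andP[xc _]; apply: dh; lra.
  rewrite in_itv/= => /andP[xc cy] ->; rewrite normrM [`|y - x|]gtr0_norm ?subr_gt0//.
  by rewrite ler_pM2r ?subr_gt0// hL//; lra.
have cl_lip x y : x <= y -> cl x <= cl y /\ cl y - cl x <= y - x.
  move=> xy; rewrite /cl.
  by case: (leP x 2^-1) => ?; case: (leP y 2^-1) => ?; case: (leP x 2) => ?;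
    case: (leP y 2) => ?; case: (leP (2^-1 : R) 2) => ?; split; lra.
exists (h \o cl), L; split => //= [x x0|x|x x2|].
- rewrite /cl; have [x1|x1] := ltP x 2^-1.
    by rewrite min_l ?(ltW h12)// !h1// ?x0 ?(ltW x1)//; lra.
  by have [//|x2] := leP x 2; rewrite !h2// ltW.
- have /andP[c1 c2] := cl_itv x; have cx : 0 <= cl x by lra.
  by rewrite h0//= -(h1 0) ?hdec//; lra.
- by rewrite h2// /cl min_r// le_max x2.
- split=> [x x1|x y].
    by rewrite h1// /cl max_r// min_l ?(ltW h12)//; lra.
  wlog xy : x y / x <= y => [hw|].
    have [/hw//|/ltW/hw] := leP x y.
    by rewrite distrC [`|x - y|]distrC.
  have [c1 c2] := cl_lip _ _ xy.
  have /andP[cx _] := cl_itv x; have /andP[_ cy] := cl_itv y.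
  rewrite distrC [`|x - y|]distrC [`|y - x|]ger0_norm ?subr_ge0//.
  by rewrite (le_trans (lip _ _ cx c1 cy))// ler_pM2l.
Qed.

(** * Approximation kernels and the Bessel kernel *)

Lemma lipschitz_measurable (R : realType) (f : R -> R) (K : R) :
  (forall x y, `|f x - f y| <= K * `|x - y|) -> measurable_fun setT f.
Proof.
move=> f_lip; apply: continuous_measurable_fun => x.
apply/cvgrPdist_le => e e0; near=> y.
apply: (le_trans (f_lip x y)).
apply: (@le_trans _ _ ((`|K| + 1) * `|x - y|)).
  by rewrite ler_wpM2r// (le_trans (ler_norm K))// lerDl.
rewrite mulrC -ler_pdivlMr ?ltr_wpDl//.
near: y; apply: cvgr_dist_le; first exact: cvg_id.
by rewrite divr_gt0// ltr_wpDl.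
Unshelve. all: by end_near. Qed.

Lemma measurable_indicator d' (Y : measurableType d') {R : realType} (b : Y -> bool) :
  measurable_fun setT b -> measurable_fun setT (fun w => (b w)%:R : R).
Proof.
move=> mb; have -> : (fun w => (b w)%:R : R) = fun w => if b w then 1 else 0.
  by apply/funext => w; case: (b w).
exact: measurable_fun_ifT.
Qed.

Section approximation_kernel.
Context {R : realType} d (X : borelMetricType d R).
Variables (m : {sigma_finite_measure set X -> \bar R}) (N c L : R) (h : R -> R).
Hypothesis c_gt0 : 0 < c.
Hypothesis m_ball : forall (x : X) (r : R), 0 < r ->
  ((c^-1 * r `^ N)%:E <= m (ball x r) <= (c * r `^ N)%:E)%E.
Hypothesis h01 : forall x, 0 <= h x <= 1.
Hypothesis h_near : forall x, x <= 2^-1 -> h x = 1.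
Hypothesis h_far : forall x, 2 <= x -> h x = 0.
Hypothesis h_lip : forall x y, `|h x - h y| <= L * `|x - y|.
Implicit Types (x y z : X) (t u : R).

Let m_regular : ahlfors_regular m N. Proof. by exists c. Qed.

Let h_ge0 (a : R) : 0 <= h a. Proof. by have /andP[] := h01 a. Qed.

Section measurability.
Context d' (Y : measurableType d').
Implicit Types (a b : Y -> X) (s : Y -> R).

Lemma measurable_dist a b : measurable_fun setT a -> measurable_fun setT b ->
  measurable_fun setT (fun w => mdist (a w) (b w)).
Proof.
by move=> ma mb; exact: (measurableT_comp (measurable_mdist m_regular) (measurable_fun_pair ma mb)).
Qed.

Lemma measurable_cutoff_dist a b s : measurable_fun setT a ->
  measurable_fun setT b -> measurable_fun setT s ->
  measurable_fun setT (fun w => h (mdist (a w) (b w) / s w)).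
Proof.
move=> ma mb ms; apply: (measurableT_comp (lipschitz_measurable h_lip)).
by apply: measurable_funM; [exact: measurable_dist|exact: measurable_funV].
Qed.

Lemma measurable_Rintegral (f : Y * X -> R) : measurable_fun setT f ->
  (forall w, 0 <= f w) ->
  measurable_fun setT (fun w => \int[m]_z f (w, z)).
Proof.
move=> mf f0; apply: measurableT_comp; first exact: fine_measurable.
apply: (measurable_fun_fubini_tonelli_F (EFin \o f)).
  exact/measurable_EFinP.
by move=> w; rewrite /= lee_fin.
Qed.

End measurability.

(** Centre and scale are arbitrary measurable functions of a parameter, so that one statement covers
    the nested averages in [psi] as well as joint measurability of the kernel in point and scale. *)
Lemma measurable_averaging d' (Y : measurableType d') (a : Y -> X) (s : Y -> R) (f : Y * X -> R) : measurable_fun setT a ->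
  measurable_fun setT s -> measurable_fun setT f -> (forall w, 0 <= f w) ->
  measurable_fun setT (fun w => averaging m N h (s w) (fun z => f (w, z)) (a w)).
Proof.
move=> ma ms mf f0; apply: measurable_funM.
  exact: (measurableT_comp (measurable_powR (- N))).
apply: (@measurable_Rintegral _ Y (fun w => h (mdist (a w.1) w.2 / s w.1) * f w)).
  apply: measurable_funM => //; apply: measurable_cutoff_dist => //.
    exact: measurableT_comp.
  exact: measurableT_comp.
by move=> w; rewrite mulr_ge0.
Qed.

Lemma averaging_ge0 t (f : X -> R) x : (forall z, 0 <= f z) ->
  0 <= averaging m N h t f x.
Proof.
by move=> f0; rewrite mulr_ge0 ?powR_ge0// Rintegral_ge0// => z _; rewrite mulr_ge0.
Qed.

Lemma phi_ge0 t x : 0 <= phi m N h t x.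
Proof. by rewrite invr_ge0 averaging_ge0// => z; exact: ler01. Qed.

Lemma psi_ge0 t x : 0 <= psi m N h t x.
Proof. by rewrite invr_ge0 averaging_ge0// => z; exact: phi_ge0. Qed.

Lemma measurable_phi d' (Y : measurableType d') (a : Y -> X) (s : Y -> R) :
  measurable_fun setT a -> measurable_fun setT s ->
  measurable_fun setT (fun w => phi m N h (s w) (a w)).
Proof.
move=> ma ms; apply: measurable_funV.
exact: (@measurable_averaging _ Y a s (cst 1)).
Qed.

Lemma measurable_psi d' (Y : measurableType d') (a : Y -> X) (s : Y -> R) :
  measurable_fun setT a -> measurable_fun setT s ->
  measurable_fun setT (fun w => psi m N h (s w) (a w)).
Proof.
move=> ma ms; apply: measurable_funV.
apply: (@measurable_averaging _ Y a s (fun w => phi m N h (s w.1) w.2)) => //.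
  by apply: measurable_phi => //; exact: measurableT_comp.
by move=> w; exact: phi_ge0.
Qed.

Lemma approx_kernel_ge0 t x y : 0 <= approx_kernel m N h t x y.
Proof.
apply: mulr_ge0; first by rewrite divr_ge0 ?mulr_ge0 ?phi_ge0 ?powR_ge0.
by apply: Rintegral_ge0 => z _; rewrite !mulr_ge0 ?psi_ge0.
Qed.

Lemma measurable_approx_kernel d' (Y : measurableType d') (a b : Y -> X)
    (s : Y -> R) : measurable_fun setT a -> measurable_fun setT b ->
  measurable_fun setT s ->
  measurable_fun setT (fun w => approx_kernel m N h (s w) (a w) (b w)).
Proof.
move=> ma mb ms.
have ms1 : measurable_fun setT (fun w : Y * X => s w.1) by exact: measurableT_comp.
apply: measurable_funM.
  apply: measurable_funM; first by apply: measurable_funM; exact: measurable_phi.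
  by apply: measurable_funV; exact: (measurableT_comp (measurable_powR (2 * N))).
apply: (@measurable_Rintegral _ Y (fun w => h (mdist (a w.1) w.2 / s w.1) *
  h (mdist (b w.1) w.2 / s w.1) * psi m N h (s w.1) w.2)).
  apply: measurable_funM; last exact: measurable_psi.
  by apply: measurable_funM; apply: measurable_cutoff_dist => //; exact: measurableT_comp.
by move=> w; rewrite !mulr_ge0 ?psi_ge0.
Qed.

(** The cutoff is 1 within distance t/2 and 0 beyond 2t; regularity at these two radii bounds
    averages of 1 below by A^-1 and above by A. *)
Local Notation A := (c * 2 `^ N).

Let A_gt0 : 0 < A. Proof. by rewrite mulr_gt0// powR_gt0. Qed.

Lemma integral_dist_lt (k : R) x (r : R) : 0 <= k ->
  (\int[m]_z (k * (mdist x z < r)%R%:R)%:E = k%:E * m (ball x r))%E.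
Proof.
move=> k0; have mB := measurable_ball_metric x r.
transitivity (\int[m]_z (k%:E * (\1_(ball x r) z)%:E))%E.
  apply: eq_integral => z _; rewrite indicE EFinM; congr (_ * (_%:R)%:E)%E.
  by congr nat_of_bool; apply/idP/idP; rewrite inE mem_ball.
rewrite ge0_integralZl//; first by rewrite integral_indic// setIT.
exact/measurable_EFinP/measurable_indic.
Qed.

Lemma averaging_integral_bounds t x (f : X -> R) (l u : R) : 0 < t ->
  0 <= l -> (forall z, l <= f z <= u) ->
  ((t `^ N * (A^-1 * l))%:E <= \int[m]_z (h (mdist x z / t) * f z)%:E
     <= (t `^ N * (A * u))%:E)%E.
Proof.
move=> t0 l0 flu.
have f0 z : 0 <= f z by have /andP[fl _] := flu z; exact: le_trans fl.
have u0 : 0 <= u by have /andP[fl fu] := flu x; exact: le_trans (le_trans l0 fl) fu.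
apply/andP; split.
- apply: (@le_trans _ _ (\int[m]_z (l * (mdist x z < t / 2)%R%:R)%:E)%E); last first.
    apply: ge0_le_integral_nomeas => z _; first by rewrite lee_fin mulr_ge0.
    rewrite lee_fin; have /andP[lf _] := flu z.
    case: (ltP (mdist x z) (t / 2)) => [xz|_]; last by rewrite mulr0 mulr_ge0.
    by rewrite h_near ?mulr1 ?mul1r// ler_pdivrMr// mulrC ltW.
  have t20 : 0 < t / 2 by rewrite divr_gt0.
  rewrite integral_dist_lt//; have /andP[lm _] := m_ball x t20.
  apply: le_trans (lee_wpmul2l _ lm); last by rewrite lee_fin.
  rewrite -EFinM lee_fin invfM powRM ?invr_ge0 ?(ltW t0)//.
  have -> : (2^-1 : R) `^ N = (2 `^ N)^-1 by rewrite -powR_inv1// -powRrM mulN1r powRN.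
  by rewrite le_eqVlt; apply/orP; left; apply/eqP; ring.
- apply: (@le_trans _ _ (\int[m]_z (u * (mdist x z < 2 * t)%R%:R)%:E)%E).
    apply: ge0_le_integral_nomeas => z _; first by rewrite lee_fin mulr_ge0.
    rewrite lee_fin; have /andP[_ fu] := flu z.
    case: (ltP (mdist x z) (2 * t)) => [xz|xz].
      rewrite mulr1 -[leRHS]mul1r ler_pM//.
      by have /andP[] := h01 (mdist x z / t).
    by rewrite h_far ?mul0r ?mulr0// ler_pdivlMr.
  have t20 : 0 < 2 * t by rewrite mulr_gt0.
  rewrite integral_dist_lt//; have /andP[_ um] := m_ball x t20.
  apply: (le_trans (lee_wpmul2l _ um)); first by rewrite lee_fin.
  rewrite -EFinM lee_fin powRM// ?(ltW t0)//.
  by rewrite le_eqVlt; apply/orP; left; apply/eqP; ring.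
Qed.

(** [averaging] takes [fine] of an integral, which is informative only once the integral is known to
    be finite; for bounded [f] the preceding upper bound ensures it. *)
Lemma averagingE t x (f : X -> R) (u : R) : 0 < t ->
  (forall z, 0 <= f z <= u) ->
  (\int[m]_z (h (mdist x z / t) * f z)%:E)%E =
  (t `^ N * averaging m N h t f x)%:E.
Proof.
move=> t0 fu; have /andP[I0 I1] := averaging_integral_bounds x t0 (lexx 0) fu.
rewrite /averaging mulrA powRN divff ?mul1r ?gt_eqF ?powR_gt0// fineK//.
rewrite ge0_fin_numE; first by apply: le_lt_trans I1 _; rewrite ltry.
by apply: le_trans I0; rewrite lee_fin !mulr_ge0 ?powR_ge0 ?invr_ge0 ?(ltW A_gt0).
Qed.

Lemma averaging_bounds t x (f : X -> R) (l u : R) : 0 < t -> 0 <= l ->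
  (forall z, l <= f z <= u) ->
  A^-1 * l <= averaging m N h t f x <= A * u.
Proof.
move=> t0 l0 flu; have := averaging_integral_bounds x t0 l0 flu.
rewrite (@averagingE t x f u)//; last first.
  by move=> z; have /andP[lf ->] := flu z; rewrite (le_trans l0).
by rewrite !lee_fin !ler_pM2l ?powR_gt0.
Qed.

(** The two cutoffs differ by at most L d(x,x') / t, and only where one of the balls of radius 2t is
    entered; the measures of these two balls give the factor [2 * A]. The bound is one-sided and
    additive, the other side following by exchanging the points. *)
Lemma averaging_lip t x x' (f : X -> R) (u : R) : 0 < t -> 0 <= L ->
  measurable_fun setT f -> (forall z, 0 <= f z <= u) ->
  averaging m N h t f x <=
    averaging m N h t f x' + 2 * A * u * L * (mdist x x' / t).
Proof.
move=> t0 L0 mf fu.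
have f0 z : 0 <= f z by have /andP[] := fu z.
have u0 : 0 <= u by have /andP[fl] := fu x; exact: le_trans.
have t20 : 0 < 2 * t by rewrite mulr_gt0.
have [e eE] : exists e, e = L * (mdist x x' / t) by eexists.
have e0 : 0 <= e by rewrite eE !mulr_ge0 ?invr_ge0 ?mdist_ge0 ?(ltW t0).
have mdl (y : X) : measurable_fun setT (fun z => (mdist y z < 2 * t)%R%:R : R).
  by apply: measurable_indicator; apply: measurable_fun_ltr => //; exact: measurable_dist.
have mhf (y : X) : measurable_fun setT (fun z => h (mdist y z / t) * f z).
  by apply: measurable_funM => //; exact: measurable_cutoff_dist.
have key : (\int[m]_z (h (mdist x z / t) * f z)%:E <=
   \int[m]_z (h (mdist x' z / t) * f z)%:E +
   (\int[m]_z (u * e * (mdist x z < 2 * t)%R%:R)%:E +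
    \int[m]_z (u * e * (mdist x' z < 2 * t)%R%:R)%:E))%E.
  have mI (y : X) : measurable_fun setT (fun z => (u * e * (mdist y z < 2 * t)%R%:R)%:E).
    by apply/measurable_EFinP; exact: measurable_funM.
  rewrite -ge0_integralD//; last 2 first.
  - by move=> z _; rewrite lee_fin !mulr_ge0.
  - by move=> z _; rewrite lee_fin !mulr_ge0.
  rewrite -ge0_integralD//; last 4 first.
  - by move=> z _; rewrite lee_fin !mulr_ge0.
  - exact/measurable_EFinP.
  - by move=> z _; rewrite adde_ge0// lee_fin !mulr_ge0.
  - exact: emeasurable_funD.
  apply: ge0_le_integral_nomeas => z _; first by rewrite lee_fin !mulr_ge0.
  rewrite -!EFinD lee_fin -mulrDr.
  have hl : h (mdist x z / t) - h (mdist x' z / t) <= e.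
    apply: (le_trans (ler_norm _)); apply: (le_trans (h_lip _ _)).
    rewrite eE ler_wpM2l// -mulrBl normrM [`|t^-1|]gtr0_norm ?invr_gt0//.
    rewrite ler_pM2r ?invr_gt0// ler_norml.
    have := metric_triangle x x' z; have := metric_triangle x' x z.
    by rewrite [mdist x' x]metric_sym => ? ?; apply/andP; split; lra.
  have [xz|xz] := ltP (mdist x z) (2 * t).
    have le1 : e <= e * (1 + (mdist x' z < 2 * t)%R%:R) by rewrite ler_peMr// lerDl.
    rewrite -mulrA [u * _]mulrC.
    apply: (@le_trans _ _ (h (mdist x' z / t) * f z + e * f z)).
      by rewrite -mulrDl ler_wpM2r//; lra.
    by rewrite lerD2l ler_pM//; have /andP[] := fu z.
  rewrite [h (mdist x z / t)]h_far ?ler_pdivlMr//.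
  by rewrite mul0r addr_ge0 ?mulr_ge0.
rewrite !integral_dist_lt ?mulr_ge0// in key.
rewrite !(@averagingE t _ f u)// in key.
have mB y : (m (ball y (2 * t)) <= (c * (2 * t) `^ N)%:E)%E by have /andP[] := m_ball y t20.
have {}key := le_trans key (leeD2l _ (leeD (lee_wpmul2l _ (mB x)) (lee_wpmul2l _ (mB x')))).
have ue0 : (0%R <= (u * e)%:E)%E by rewrite lee_fin mulr_ge0.
have {key} := key ue0 ue0.
rewrite -!EFinM -!EFinD lee_fin powRM ?(ltW t0)// => key.
rewrite -(@ler_pM2l _ (t `^ N)) ?powR_gt0//; apply: (le_trans key).
by rewrite le_eqVlt; apply/orP; left; apply/eqP; rewrite eE; ring.
Qed.

Let inv_bounds (B v : R) : 0 < B -> B^-1 <= v <= B -> B^-1 <= v^-1 <= B.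
Proof.
move=> B0 /andP[Bv vB]; have v0 : 0 < v by apply: lt_le_trans Bv; rewrite invr_gt0.
by rewrite lef_pV2 ?posrE// vB /= -[leRHS]invrK lef_pV2 ?posrE// invr_gt0.
Qed.

Lemma phi_bounds t x : 0 < t -> A^-1 <= phi m N h t x <= A.
Proof.
move=> t0; apply: inv_bounds => //.
by have := @averaging_bounds t x (cst 1) 1 1 t0 ler01; rewrite !mulr1; apply => z; rewrite /= lexx.
Qed.

Lemma psi_bounds t x : 0 < t -> 0 <= psi m N h t x <= A ^+ 2.
Proof.
move=> t0; rewrite psi_ge0 /=; have A2 : 0 < A ^+ 2 by rewrite exprn_gt0.
have /andP[//] : (A ^+ 2)^-1 <= psi m N h t x <= A ^+ 2.
apply: inv_bounds => //; rewrite expr2 invfM.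
apply: averaging_bounds => //; first by rewrite invr_ge0 ltW.
by move=> z; exact: phi_bounds.
Qed.

(** For the two values p and q, p - q = p q (1/q - 1/p); here 1/q - 1/p is a difference of averages
    of 1, at most 2 A L d(x,x') / t, and p q <= A^2. *)
Lemma phi_lip t x x' : 0 < t -> 0 <= L ->
  phi m N h t x <= phi m N h t x' + 2 * A ^+ 3 * L * (mdist x x' / t).
Proof.
move=> t0 L0.
have /andP[a1 a2] := phi_bounds x t0; have /andP[b1 b2] := phi_bounds x' t0.
have := @averaging_lip t x' x (cst 1) 1 t0 L0; rewrite mulr1 [mdist x' x]metric_sym.
have one (z : X) : 0 <= (cst 1 z : R) <= 1 by rewrite /= ler01 lexx.
move=> /(_ (measurable_cst _) one); rewrite -/(phi _ _ _ _ _).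
rewrite -[averaging _ _ _ _ _ x']invrK -[averaging _ _ _ _ _ x]invrK.
rewrite -/(phi m N h t x) -/(phi m N h t x').
move: (phi m N h t x) (phi m N h t x') a1 a2 b1 b2 => p q a1 a2 b1 b2.
have p0 : 0 < p by apply: lt_le_trans a1; rewrite invr_gt0.
have q0 : 0 < q by apply: lt_le_trans b1; rewrite invr_gt0.
have : 0 <= 2 * A * L * (mdist x x' / t).
  by rewrite !mulr_ge0 ?invr_ge0 ?mdist_ge0 ?(ltW t0) ?(ltW A_gt0)// ltW.
have -> : 2 * A ^+ 3 * L * (mdist x x' / t) = A ^+ 2 * (2 * A * L * (mdist x x' / t)) by ring.
move: (2 * A * L * _) => e e0 h1.
have pq : p * q <= A ^+ 2 by rewrite expr2 ler_pM// ltW.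
apply: (@le_trans _ _ (q + p * q * e)); last by rewrite lerD2l ler_wpM2r.
have : p * q * q^-1 <= p * q * (p^-1 + e) by rewrite ler_wpM2l// mulr_ge0// ltW.
by rewrite mulrDr mulrK ?unitf_gt0// [p * q * p^-1]mulrAC divff ?gt_eqF// mul1r.
Qed.

(** As a function of [x] the kernel is [phi] times an average of a bounded function, so its size and
    its Lipschitz constant follow from those of [phi] and of averages. *)
Lemma approx_kernelE t x y : 0 < t ->
  approx_kernel m N h t x y = phi m N h t x * phi m N h t y * t `^ (- N) *
    averaging m N h t (fun z => h (mdist y z / t) * psi m N h t z) x.
Proof.
move=> t0; rewrite /approx_kernel /averaging.
have -> : t `^ (2 * N) = t `^ N * t `^ N.
  have -> : 2 * N = N + N by ring.
  by rewrite powRD//; apply/implyP => _; rewrite gt_eqF.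
rewrite invfM -powRN !mulrA; congr (_ * _).
by apply: eq_Rintegral => z _; rewrite mulrA.
Qed.

Let hpsi_bounds t y z : 0 < t -> 0 <= h (mdist y z / t) * psi m N h t z <= A ^+ 2.
Proof.
move=> t0; have /andP[p0 p1] := psi_bounds z t0.
rewrite mulr_ge0//= -[leRHS]mul1r ler_pM//.
by have /andP[] := h01 (mdist y z / t).
Qed.

(** The exponent 5 counts two factors [phi], one average, and two for [psi]. The kernel vanishes
    beyond 4t because no [z] is then within 2t of both points. *)
Lemma approx_kernel_le t x y : 0 < t ->
  approx_kernel m N h t x y <= A ^+ 5 * (t `^ (- N) * (mdist x y < 4 * t)%R%:R).
Proof.
move=> t0; have [xy|xy] := ltP (mdist x y) (4 * t); last first.
  rewrite /approx_kernel (_ : \int[m]_z _ = 0) ?mulr0//.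
  under eq_Rintegral => z _.
    rewrite [h _ * h _](_ : _ = 0) ?mul0r; first over.
    have [xz|xz] := ltP (mdist x z) (2 * t); last first.
      by rewrite h_far ?mul0r// ler_pdivlMr.
    rewrite [X in _ * X]h_far ?mulr0// ler_pdivlMr//.
    by have := metric_triangle x z y; rewrite [mdist z y]metric_sym; lra.
  by rewrite /Rintegral integral0.
rewrite mulr1 approx_kernelE//.
have /andP[V0 V1] := averaging_bounds x t0 (lexx 0) (fun z => hpsi_bounds y z t0).
rewrite mulr0 in V0.
have /andP[_ a2] := phi_bounds x t0; have /andP[_ b2] := phi_bounds y t0.
apply: (@le_trans _ _ (A * A * t `^ (- N) * (A * A ^+ 2))).
  apply: ler_pM => //; first by rewrite !mulr_ge0 ?phi_ge0 ?powR_ge0.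
  apply: ler_wpM2r; first exact: powR_ge0.
  by apply: ler_pM; rewrite ?phi_ge0.
by rewrite le_eqVlt; apply/orP; left; apply/eqP; ring.
Qed.

(** Product rule for [phi] times the average: varying the average yields the term with A^5, varying
    [phi] the term with A^7; each already includes a factor [A] for [phi] at [y]. *)
Lemma approx_kernel_lip t x x' y : 0 < t -> 0 <= L ->
  approx_kernel m N h t x y <= approx_kernel m N h t x' y +
    (2 * A ^+ 5 * L + 2 * A ^+ 7 * L) * (t `^ (- N) * (mdist x x' / t)).
Proof.
move=> t0 L0; rewrite !approx_kernelE//.
have mf : measurable_fun setT (fun z => h (mdist y z / t) * psi m N h t z).
  apply: measurable_funM; first exact: measurable_cutoff_dist.
  exact: (@measurable_psi _ X id (cst t)).
have := @averaging_lip t x x' _ _ t0 L0 mf (fun z => hpsi_bounds y z t0).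
have /andP[V0 V1] := averaging_bounds x' t0 (lexx 0) (fun z => hpsi_bounds y z t0).
rewrite mulr0 in V0; move: V0 V1.
move: (averaging _ _ _ _ _ x) (averaging _ _ _ _ _ x') => V V' V0 V1 hV.
have hp := phi_lip x x' t0 L0.
have /andP[_ px] := phi_bounds x t0; have px0 := phi_ge0 t x.
have /andP[_ py] := phi_bounds y t0; have py0 := phi_ge0 t y.
have px'0 := phi_ge0 t x'.
have tN := powR_ge0 t (- N).
have d0 : 0 <= mdist x x' / t by rewrite divr_ge0 ?mdist_ge0// ltW.
have A0 := ltW A_gt0.
move: (phi m N h t x) (phi m N h t y) (phi m N h t x') (t `^ (- N)) (mdist x x' / t) A
  px px0 py py0 px'0 tN d0 hV hp V1 A0 => p q p' T e B px px0 py py0 px'0 T0 e0 hV hp V1 B0.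
have pV : p * V <= p' * V' + (2 * B ^+ 4 * L + 2 * B ^+ 6 * L) * e.
  apply: (@le_trans _ _ (p * (V' + 2 * B * B ^+ 2 * L * e))); first by rewrite ler_wpM2l.
  rewrite mulrDr.
  have h1 : p * V' <= p' * V' + 2 * B ^+ 3 * L * e * (B * B ^+ 2).
    apply: (@le_trans _ _ ((p' + 2 * B ^+ 3 * L * e) * V')); first by rewrite ler_wpM2r.
    by rewrite mulrDl lerD2l ler_wpM2l// !mulr_ge0// exprn_ge0.
  have h2 : p * (2 * B * B ^+ 2 * L * e) <= B * (2 * B * B ^+ 2 * L * e).
    by rewrite ler_wpM2r// !mulr_ge0// exprn_ge0.
  apply: (le_trans (lerD h1 h2)).
  by rewrite le_eqVlt; apply/orP; left; apply/eqP; ring.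
have -> : p * q * T * V = q * T * (p * V) by ring.
have -> : p' * q * T * V' = q * T * (p' * V') by ring.
apply: (le_trans (ler_wpM2l (mulr_ge0 py0 T0) pV)).
rewrite mulrDr lerD2l.
apply: (@le_trans _ _ (B * T * ((2 * B ^+ 4 * L + 2 * B ^+ 6 * L) * e))).
  by rewrite !ler_wpM2r// mulr_ge0// addr_ge0// !mulr_ge0// exprn_ge0.
by rewrite le_eqVlt; apply/orP; left; apply/eqP; ring.
Qed.

(* Trivial bound for t <= r, Lipschitz bound for t >= r. *)
Lemma approx_kernel_diff : 0 <= L -> exists2 C : R, 0 < C &
  forall (t r : R) x x' y, 0 < t -> 0 < r -> mdist x x' < r ->
  approx_kernel m N h t x y <= C * (t `^ (- N) * (mdist x y < 4 * t)%R%:R) /\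
  approx_kernel m N h t x y <= approx_kernel m N h t x' y +
    C * Num.min 1 (r / t) * (t `^ (- N) *
      ((mdist x y < 4 * t)%R%:R + (mdist x' y < 4 * t)%R%:R)).
Proof.
move=> L0; have A0 := ltW A_gt0.
have C1 : 0 < A ^+ 5 by rewrite exprn_gt0.
have C2 : 0 <= 2 * A ^+ 5 * L + 2 * A ^+ 7 * L by rewrite addr_ge0 ?mulr_ge0 ?exprn_ge0 ?mulr_ge0 ?powR_ge0 ?(ltW c_gt0).
exists (A ^+ 5 + (2 * A ^+ 5 * L + 2 * A ^+ 7 * L)); first by rewrite ltr_pwDl.
move=> t r x x' y t0 r0 xr.
have := @approx_kernel_lip t x x' y t0 L0; have := approx_kernel_le x y t0.
have s0 := approx_kernel_ge0 t x' y.
move: (A ^+ 5) (2 * A ^+ 5 * L + 2 * A ^+ 7 * L) C1 C2 => C D C0 D0 h1 h2.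
have T0 := powR_ge0 t (- N).
have CD (a : R) : 0 <= a -> C * a <= (C + D) * a by move=> a0; rewrite ler_wpM2r// lerDl.
have rt0 : 0 < r / t by rewrite divr_gt0.
split; first by apply: (le_trans h1); apply: CD; rewrite mulr_ge0.
(* The Lipschitz bound is not localised. If both points are at distance at least 4t from [y], the
   left side is 0; otherwise the sum of the two indicators is at least 1 and may be inserted. *)
have [far|near] := boolP ((4 * t <= mdist x y) && (4 * t <= mdist x' y)).
  have /andP[f1 f2] := far.
  move: h1; rewrite ltNge f1 ltNge f2 /= addr0 !mulr0 addr0 => h1.
  exact: le_trans h1 s0.
have k1 : 1 <= (mdist x y < 4 * t)%R%:R + (mdist x' y < 4 * t)%R%:R :> R.
  by rewrite -natrD ler1n; move: near; rewrite negb_and -!ltNge => /orP[] ->//; rewrite addn1.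
have T1 : t `^ (- N) <= t `^ (- N) * ((mdist x y < 4 * t)%R%:R + (mdist x' y < 4 * t)%R%:R).
  by rewrite ler_peMr.
have [_|_] := leP 1 (r / t).
  rewrite mulr1; apply: (le_trans h1); apply: (@le_trans _ _ ((C + D) * t `^ (- N))).
    apply: (@le_trans _ _ (C * t `^ (- N))); last exact: CD.
    by rewrite ler_wpM2l ?(ltW C0)// ler_piMr// lern1 leq_b1.
  have CD0 : 0 <= C + D by rewrite addr_ge0// ltW.
  apply: (le_trans (ler_wpM2l CD0 T1)); by rewrite lerDr.
apply: (le_trans h2); rewrite lerD2l.
apply: (@le_trans _ _ ((C + D) * (r / t) * t `^ (- N))); last first.
  by apply: ler_wpM2l => //; rewrite mulr_ge0 ?addr_ge0 ?(ltW C0) ?(ltW rt0).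
rewrite (_ : D * (_ * _) = D * (mdist x x' / t) * t `^ (- N)); last by ring.
apply: ler_wpM2r => //.
apply: ler_pM => //; first by rewrite divr_ge0 ?mdist_ge0// ltW.
  by rewrite lerDr ltW.
by rewrite ler_pM2r ?invr_gt0// ltW.
Qed.

(** * Radial kernels and their mass *)

Section radial_kernel.
Local Open Scope ereal_scope.
Implicit Types w : R -> R.

(* The factor [mdist z.1 z.2 < 4 * u] kills all [u <= 0]. *)
Definition radial_kernel w (z : X * X) : \bar R :=
  \int[lebesgue_measure]_u
    (w u * (u `^ (- N) * (mdist z.1 z.2 < 4 * u)%R%:R))%:E.

Let integrand_ge0 w (r u : R) : (forall v, 0 <= v -> 0 <= w v)%R -> (0 <= r)%R ->
  (0 <= w u * (u `^ (- N) * (r < 4 * u)%R%:R))%R.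
Proof.
move=> w0 r0; case: ltP => [ru|_]; last by rewrite !mulr0.
by rewrite !mulr_ge0 ?powR_ge0 ?w0//; lra.
Qed.

Let measurable_integrand w (x y : X) : measurable_fun setT w ->
  measurable_fun setT (fun u => (w u * (u `^ (- N) * (mdist x y < 4 * u)%R%:R)))%R.
Proof.
move=> mw; apply: measurable_funM => //; apply: measurable_funM; first exact: measurable_powR.
by apply: measurable_indicator; apply: measurable_fun_ltr => //; exact: measurable_funM.
Qed.

Let measurable_integrand3 w : measurable_fun setT w ->
  measurable_fun setT (fun v : (X * X) * measurableTypeR R =>
    (w v.2 * (v.2 `^ (- N) * (mdist v.1.1 v.1.2 < 4 * v.2)%R%:R)))%R.
Proof.
move=> mw; apply: measurable_funM; first exact: (measurableT_comp mw measurable_snd).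
apply: measurable_funM; first exact: (measurableT_comp (measurable_powR (- N)) measurable_snd).
apply: measurable_indicator; apply: measurable_fun_ltr.
  by apply: measurable_dist; exact: measurableT_comp.
exact: measurable_funM.
Qed.

Lemma radial_kernel_ge0 w (p : X * X) : (forall v, 0 <= v -> 0 <= w v)%R ->
  0 <= radial_kernel w p.
Proof.
move=> w0; apply: integral_ge0 => u _.
by rewrite lee_fin integrand_ge0// mdist_ge0.
Qed.

Lemma radial_kernelC w x y : radial_kernel w (x, y) = radial_kernel w (y, x).
Proof. by rewrite /radial_kernel /= metric_sym. Qed.

(** The integral over the whole line suits Tonelli; the one over the half-line matches the
    definition of the Bessel kernel. *)
Lemma radial_kernel_pos w x y :
  radial_kernel w (x, y) = \int[lebesgue_measure]_(u in `]0%R, +oo[)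
    (w u * (u `^ (- N) * (mdist x y < 4 * u)%R%:R))%:E.
Proof.
rewrite [RHS]integral_mkcond; apply: eq_integral => u _.
rewrite patchE; case: ifPn => //; rewrite notin_setE /= in_itv/= andbT => /negP.
rewrite -leNgt => u0; rewrite ltNge (_ : 4 * u <= mdist x y)%R ?mulr0//.
by apply: (@le_trans _ _ 0%R); rewrite ?mdist_ge0// mulr_ge0_le0.
Qed.

Lemma measurable_radial_kernel w : measurable_fun setT w ->
  (forall v, 0 <= v -> 0 <= w v)%R -> measurable_fun setT (radial_kernel w).
Proof.
move=> mw w0.
apply: (@measurable_fun_fubini_tonelli_F _ _ _ (measurableTypeR R) R lebesgue_measure
  (fun v : (X * X) * measurableTypeR R =>
    (w v.2 * (v.2 `^ (- N) * (mdist v.1.1 v.1.2 < 4 * v.2)%R%:R))%:E)).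
  by apply/measurable_EFinP; exact: measurable_integrand3.
by move=> v; rewrite lee_fin integrand_ge0// mdist_ge0.
Qed.

(** Integrating in [z] first by Tonelli, the ball of radius 4u has measure at most c 4^N u^N, which
    cancels the factor u^-N and leaves the integral of [w]. *)
Lemma radial_kernel_mass w (W : R) x : measurable_fun setT w ->
  (forall v, 0 <= v -> 0 <= w v)%R ->
  \int[lebesgue_measure]_(u in `]0%R, +oo[) (w u)%:E <= W%:E ->
  \int[m]_z radial_kernel w (x, z) <= (c * 4 `^ N * W)%:E.
Proof.
move=> mw w0 wW.
pose F (v : X * measurableTypeR R) :=
  (w v.2 * (v.2 `^ (- N) * (mdist x v.1 < 4 * v.2)%R%:R))%:E.
have mF : measurable_fun setT F.
  have mp : measurable_fun setT (fun v : X * measurableTypeR R => ((x, v.1), v.2)).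
    apply: measurable_fun_pair; last exact: measurable_snd.
    by apply: measurable_fun_pair => //; exact: measurable_fst.
  by apply/measurable_EFinP; exact: (measurableT_comp (measurable_integrand3 mw) mp).
have F0 v : 0 <= F v by rewrite lee_fin integrand_ge0// mdist_ge0.
rewrite /radial_kernel /= (@fubini_tonelli _ _ _ _ _ _ _ F)//.
have k0 : (0 <= c * 4 `^ N)%R by rewrite mulr_ge0 ?powR_ge0// ltW.
rewrite EFinM; apply: le_trans (lee_wpmul2l _ wW); last by rewrite lee_fin.
rewrite -ge0_integralZl//; first last.
- by move=> u; rewrite /= in_itv/= andbT => u0; rewrite lee_fin w0// ltW.
- by apply: measurable_funTS; exact/measurable_EFinP.
rewrite [leRHS]integral_mkcond; apply: ge0_le_integral_nomeas => u _.
  exact: integral_ge0.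
rewrite patchE /F /=; case: ifPn => [|]; rewrite ?inE ?notin_setE /= in_itv/= andbT.
  move=> u0; under eq_integral do rewrite mulrA.
  rewrite integral_dist_lt; last by rewrite mulr_ge0 ?powR_ge0 ?w0// ltW.
  have u40 : (0 < 4 * u)%R by rewrite mulr_gt0.
  have /andP[_ mB] := m_ball x u40.
  apply: (le_trans (lee_wpmul2l _ mB)); first by rewrite lee_fin mulr_ge0 ?powR_ge0 ?w0// ltW.
  rewrite -!EFinM lee_fin powRM// ?(ltW u0)// powRN.
  by rewrite le_eqVlt; apply/orP; left; apply/eqP; field; rewrite gt_eqF ?powR_gt0.
move=> /negP; rewrite -leNgt => u0; rewrite integral0_eq// => z _.
rewrite ltNge (_ : 4 * u <= mdist x z)%R ?mulr0//.
by apply: (@le_trans _ _ 0%R); rewrite ?mdist_ge0// mulr_ge0_le0.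
Qed.

(** * Comparison of the Bessel kernel with radial kernels *)

Section bessel.
Variable a : R.
Hypothesis a01 : (0 < a < 1)%R.

Let a_gt0 : (0 < a)%R. Proof. by case/andP: a01. Qed.

Lemma bessel_kernelE x y :
  bessel_kernel m N h a x y = a%:E * \int[lebesgue_measure]_(t in `]0%R, +oo[)
    (weight a 1 t * approx_kernel m N h t x y)%:E.
Proof.
congr (_ * _); apply: eq_integral => t _; congr EFin.
by rewrite /weight powR1 mul1r; ring.
Qed.

Let weight_kernel_ge0 x y (t : R) : `]0%R, +oo[%classic t ->
  0 <= (weight a 1 t * approx_kernel m N h t x y)%:E.
Proof.
rewrite /= in_itv/= andbT => t0.
by rewrite lee_fin mulr_ge0 ?approx_kernel_ge0 ?weight_ge0// ltW.
Qed.

Lemma bessel_kernel_ge0 x y : 0 <= bessel_kernel m N h a x y.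
Proof.
rewrite bessel_kernelE mule_ge0 ?lee_fin ?(ltW a_gt0)//.
by apply: integral_ge0 => t; exact: weight_kernel_ge0.
Qed.

Lemma measurable_bessel_kernel x : measurable_fun setT (bessel_kernel m N h a x).
Proof.
(* The integrand is extended by 0 to t <= 0, since Tonelli requires nonnegativity on the whole
   product. *)
rewrite (_ : bessel_kernel m N h a x = fun y => a%:E * \int[lebesgue_measure]_t
    (if (0 < t)%R then weight a 1 t * approx_kernel m N h t x y else 0%R)%:E); last first.
  apply/funext => y; rewrite bessel_kernelE; congr (_ * _).
  rewrite integral_mkcond; apply: eq_integral => t _; rewrite patchE mem_setE in_itv/= andbT.
  by case: ifP.
apply: emeasurable_funM => //.
apply: (@measurable_fun_fubini_tonelli_F _ _ X (measurableTypeR R) R lebesgue_measure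
  (fun v : X * measurableTypeR R =>
    (if (0 < v.2)%R then weight a 1 v.2 * approx_kernel m N h v.2 x v.1 else 0%R)%:E)); last first.
  move=> v; rewrite lee_fin; case: ifP => // v0.
  by rewrite mulr_ge0 ?approx_kernel_ge0 ?weight_ge0// ltW.
have m2 : measurable_fun setT (fun v : X * measurableTypeR R => (v.2 : R)).
  exact: measurable_snd.
apply/measurable_EFinP; apply: measurable_fun_ifT => //; first exact: measurable_fun_ltr.
apply: measurable_funM; first exact: (measurableT_comp (measurable_weight a 1) m2).
exact: (@measurable_approx_kernel _ _ (cst x) fst snd).
Qed.

(** Both estimates integrate [approx_kernel_diff] over the scale: its first part gives the size, its
    second together with [weight_min_le] the variation. The additive form stays meaningful where the
    kernels are infinite. *)
Lemma bessel_kernel_bounds : (0 <= L)%R -> exists2 C : R, (0 < C)%R &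
  (forall x y, bessel_kernel m N h a x y <= C%:E * radial_kernel (weight a 1) (x, y)) /\
  (forall (r : R) x x' y, (0 < r)%R -> (mdist x x' < r)%R ->
    bessel_kernel m N h a x y <= bessel_kernel m N h a x' y +
      C%:E * (radial_kernel (split_weight a r) (x, y) +
              radial_kernel (split_weight a r) (x', y))).
Proof.
move=> L0; have [C C0 hC] := approx_kernel_diff L0.
have a0 := ltW a_gt0.
exists (a * C)%R; first by rewrite mulr_gt0.
have posI (w : R -> R) x y : (forall v, 0 <= v -> 0 <= w v)%R -> forall t : R,
    `]0%R, +oo[%classic t -> 0 <= (w t * (t `^ (- N) * (mdist x y < 4 * t)%R%:R))%:E.
  by move=> w0 t _; rewrite lee_fin integrand_ge0// mdist_ge0.
have measI (w : R -> R) x y : measurable_fun setT w ->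
    measurable_fun (`]0%R, +oo[%classic : set (measurableTypeR R))
      (fun t : R => (w t * (t `^ (- N) * (mdist x y < 4 * t)%R%:R))%:E).
  by move=> mw; apply: measurable_funTS; apply/measurable_EFinP; exact: measurable_integrand.
split=> [x y|r x x' y r0 xr]; rewrite !bessel_kernelE !radial_kernel_pos EFinM -muleA.
- apply: lee_wpmul2l; first by rewrite lee_fin.
  rewrite -ge0_integralZl//; first last.
  - by rewrite lee_fin ltW.
  - by apply: posI => v; exact: weight_ge0.
  - by apply: measI; exact: measurable_weight.
  apply: ge0_le_integral_nomeas => t; first exact: weight_kernel_ge0.
  rewrite /= in_itv/= andbT => t0; rewrite -EFinM lee_fin [leRHS]mulrCA.
  apply: ler_wpM2l; first by rewrite weight_ge0// ltW.
  (* Only the size bound is wanted here, so a trivial displacement is supplied. *)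
  by have [|] := hC t 1%R x x y t0 ltr01; first by rewrite mdistxx.
have mS := measurable_split_weight a r; have S0 v := @split_weight_ge0 _ a r v.
rewrite -ge0_muleDr; last 2 first.
- by apply: integral_ge0 => t; exact: weight_kernel_ge0.
- rewrite mule_ge0 ?lee_fin ?(ltW C0)//.
  by rewrite adde_ge0//; apply: integral_ge0 => t; exact: posI.
apply: lee_wpmul2l; first by rewrite lee_fin.
rewrite -ge0_integralD//; [|exact: posI|exact: measI|exact: posI|exact: measI].
rewrite -ge0_integralZl//; last 3 first.
- by apply: emeasurable_funD; exact: measI.
- by move=> t t0; rewrite adde_ge0// posI.
- by rewrite lee_fin ltW.
rewrite -ge0_integralD//; last 4 first.
- exact: weight_kernel_ge0.
- apply: measurable_funTS; apply/measurable_EFinP; apply: measurable_funM.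
    exact: measurable_weight.
  exact: (@measurable_approx_kernel _ _ (cst x') (cst y) id).
- by move=> t t0; rewrite mule_ge0 ?adde_ge0 ?posI// lee_fin ltW.
- by apply: emeasurable_funM => //; apply: emeasurable_funD; exact: measI.
apply: ge0_le_integral_nomeas => t; first exact: weight_kernel_ge0.
rewrite /= in_itv/= andbT => t0; rewrite -EFinD lee_fin.
have [_ h1] := hC t r x x' y t0 r0 xr.
have b0 : (0 <= weight a 1 t)%R by rewrite weight_ge0// ltW.
apply: (le_trans (ler_wpM2l b0 h1)); rewrite mulrDr lerD2l.
move: (_%:R) (_%:R) (ler0n R (mdist x y < 4 * t)%R) (ler0n R (mdist x' y < 4 * t)%R).
move=> i j i0 j0.
rewrite [leLHS](_ : _ = C * (weight a 1 t * Num.min 1 (r / t) * (t `^ (- N) * (i + j))))%R; last by ring.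
rewrite [leRHS](_ : _ = C * (split_weight a r t * (t `^ (- N) * (i + j))))%R; last by ring.
apply: ler_wpM2l; first exact: ltW.
by apply: ler_wpM2r; rewrite ?weight_min_le// mulr_ge0 ?powR_ge0// addr_ge0.
Qed.

End bessel.
End radial_kernel.
End approximation_kernel.

(** * Regularity of potentials *)

Section signed_integral.
Context d (T : measurableType d) (R : realType).
Variable mu : {measure set T -> \bar R}.
Local Open Scope ereal_scope.
Implicit Types (g : T -> R) (k q : T -> \bar R).

(** A difference in [\bar R] with an infinite term is never a real number, not even for +oo - +oo; a
    real value of the integral thus forces both parts to be finite. *)
Lemma integral_mul_posneg g k (v : R) : (forall z, 0 <= k z) ->
  \int[mu]_z ((g z)%:E * k z) = v%:E ->
  [/\ \int[mu]_z ((Num.max (g z) 0)%:E * k z) \is a fin_num,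
      \int[mu]_z ((Num.max (- g z) 0)%:E * k z) \is a fin_num &
      v%:E = \int[mu]_z ((Num.max (g z) 0)%:E * k z) -
             \int[mu]_z ((Num.max (- g z) 0)%:E * k z)].
Proof.
move=> k0; rewrite integralE => gk.
have posE : \int[mu]_z ((fun z => (g z)%:E * k z)^\+ z) =
    \int[mu]_z ((Num.max (g z) 0)%:E * k z).
  apply: eq_integral => z _; rewrite funeposE.
  have [g0|g0] := leP (g z) 0%R.
    by rewrite mul0e max_r// mule_le0_ge0.
  by rewrite max_l// mule_ge0// lee_fin ltW.
have negE : \int[mu]_z ((fun z => (g z)%:E * k z)^\- z) =
    \int[mu]_z ((Num.max (- g z) 0)%:E * k z).
  apply: eq_integral => z _; rewrite funenegE -mulNe -EFinN.
  have [g0|g0] := leP (- g z)%R 0%R.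
    by rewrite mul0e max_r// mule_le0_ge0.
  by rewrite max_l// mule_ge0// lee_fin ltW.
rewrite posE negE in gk.
have P0 : 0 <= \int[mu]_z ((Num.max (g z) 0)%:E * k z).
  by apply: integral_ge0 => z _; rewrite mule_ge0// lee_fin le_max lexx orbT.
have M0 : 0 <= \int[mu]_z ((Num.max (- g z) 0)%:E * k z).
  by apply: integral_ge0 => z _; rewrite mule_ge0// lee_fin le_max lexx orbT.
move: gk P0 M0.
case: (\int[mu]_z _) => [p| |]; case: (\int[mu]_z _) => [n| |] //= gk _ _.
Qed.

Let sub_le (p1 n1 p2 n2 a b : \bar R) : p1 \is a fin_num -> n1 \is a fin_num ->
  p2 \is a fin_num -> n2 \is a fin_num -> 0 <= a -> 0 <= b ->
  p1 <= p2 + a -> n2 <= n1 + b -> p1 - n1 <= p2 - n2 + (a + b).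
Proof.
move: p1 n1 p2 n2 a b => [p1| |] // [n1| |] // [p2| |] // [n2| |] // a b _ _ _ _.
move: a b => [a| |] // [b| |] //= a0 b0; rewrite ?leey//.
by rewrite -!EFinD !lee_fin => ? ?; lra.
Qed.

(** The comparison of [k1] with [k2] is integrated against the positive part of [g], the reverse one
    against the negative part; subtracting finite integrals leaves the errors, which add up to the
    integral of |g| q. *)
Lemma integral_diff_le g k1 k2 q (v1 v2 : R) : measurable_fun setT g ->
  measurable_fun setT k1 -> measurable_fun setT k2 -> measurable_fun setT q ->
  (forall z, 0 <= k1 z) -> (forall z, 0 <= k2 z) -> (forall z, 0 <= q z) ->
  (forall z, k1 z <= k2 z + q z) -> (forall z, k2 z <= k1 z + q z) ->
  \int[mu]_z ((g z)%:E * k1 z) = v1%:E -> \int[mu]_z ((g z)%:E * k2 z) = v2%:E ->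
  v1%:E <= v2%:E + \int[mu]_z (`|g z|%:E * q z).
Proof.
move=> mg mk1 mk2 mq k10 k20 q0 k12 k21.
move=> /(integral_mul_posneg k10)[P1 M1 ->] /(integral_mul_posneg k20)[P2 M2 ->].
have mgp : measurable_fun setT (fun z => (Num.max (g z) 0)%:E).
  by apply/measurable_EFinP; exact: measurable_maxr.
have mgn : measurable_fun setT (fun z => (Num.max (- g z) 0)%:E).
  apply/measurable_EFinP; apply: measurable_maxr => //; exact: measurableT_comp.
have gp0 z : 0 <= (Num.max (g z) 0)%:E by rewrite lee_fin le_max lexx orbT.
have gn0 z : 0 <= (Num.max (- g z) 0)%:E by rewrite lee_fin le_max lexx orbT.
have le_int (w : T -> \bar R) ka kb : measurable_fun setT w -> (forall z, 0 <= w z) ->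
    measurable_fun setT kb -> (forall z, 0 <= ka z) -> (forall z, 0 <= kb z) ->
    (forall z, ka z <= kb z + q z) ->
    \int[mu]_z (w z * ka z) <= \int[mu]_z (w z * kb z) + \int[mu]_z (w z * q z).
  move=> mw w0 mkb ka0 kb0 kab; rewrite -ge0_integralD//; first last.
  - exact: emeasurable_funM.
  - by move=> z _; exact: mule_ge0.
  - exact: emeasurable_funM.
  - by move=> z _; exact: mule_ge0.
  apply: ge0_le_integral_nomeas => z _; first exact: mule_ge0.
  by rewrite -ge0_muleDr//; apply: lee_wpmul2l.
have hp := le_int _ _ _ mgp gp0 mk2 k10 k20 k12.
have hn := le_int _ _ _ mgn gn0 mk1 k20 k10 k21.
have -> : \int[mu]_z (`|g z|%:E * q z) = \int[mu]_z ((Num.max (g z) 0)%:E * q z) +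
    \int[mu]_z ((Num.max (- g z) 0)%:E * q z).
  rewrite -ge0_integralD//; first last.
  - exact: emeasurable_funM.
  - by move=> z _; exact: mule_ge0.
  - exact: emeasurable_funM.
  - by move=> z _; exact: mule_ge0.
  apply: eq_integral => z _; rewrite -ge0_muleDl//; congr (_ * _).
  rewrite -EFinD; congr EFin; have [g0|g0] := leP (g z) 0%R.
    by rewrite ler0_norm// max_l ?oppr_ge0// add0r.
  by rewrite gtr0_norm// max_r ?oppr_le0 ?(ltW g0)// addr0.
have qp0 : 0 <= \int[mu]_z ((Num.max (g z) 0)%:E * q z).
  by apply: integral_ge0 => z _; exact: mule_ge0.
have qn0 : 0 <= \int[mu]_z ((Num.max (- g z) 0)%:E * q z).
  by apply: integral_ge0 => z _; exact: mule_ge0.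
exact: sub_le.
Qed.
End signed_integral.

Lemma poweRD_le (R : realType) (r : R) (u v : \bar R) : 0 < r -> (0 <= u -> 0 <= v ->
  (u + v) `^ r <= (2 `^ r)%:E * (u `^ r + v `^ r))%E.
Proof.
move=> r0.
have half (x y : \bar R) : (0 <= y -> y <= x ->
    (x + y) `^ r <= (2 `^ r)%:E * (x `^ r + y `^ r))%E.
  move=> y0 yx; have x0 := le_trans y0 yx.
  apply: (@le_trans _ _ ((2%:E * x) `^ r)%E).
    apply: le_poweR; rewrite ?adde_ge0 ?(ltW r0)//.
    by rewrite -[2]/(1 + 1) EFinD ge0_muleDl// !mul1e leeD2l.
  rewrite poweRM// poweR_EFin; apply: lee_wpmul2l; first by rewrite lee_fin powR_ge0.
  by rewrite leeDl// poweR_ge0.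
move=> u0 v0; have [uv|/ltW vu] := leP u v; last exact: half.
by rewrite addeC [(u `^ r + _)%E]addeC half.
Qed.

(** * Control of the modulus by a one-variable majorant *)

Section modulus_bound.
Context {R : realType} d (X : borelMetricType d R).
Variables (m : {sigma_finite_measure set X -> \bar R}) (N c : R).
Hypothesis c_gt0 : 0 < c.
Hypothesis m_ball : forall (x : X) (r : R), 0 < r ->
  ((c^-1 * r `^ N)%:E <= m (ball x r) <= (c * r `^ N)%:E)%E.
Hypothesis m_gt0 : (0 < m setT)%E.
Implicit Types x y : X.
Local Open Scope ereal_scope.

Let m_regular : ahlfors_regular m N. Proof. by exists c. Qed.

(** Regularity replaces the ball average by the symmetric kernel [k], whose rows and columns have
    mass at most c^2. The term in F x uses the row mass, the term in F y Tonelli and the column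
    mass, giving 2 c^2; the factor 2^p comes from the power of a sum. *)
Lemma modulus_fin_le (p t : R) (f : X -> R) (F : X -> \bar R) : (0 < p)%R ->
  (0 < t)%R -> measurable_fun setT F -> (forall x, 0 <= F x) ->
  (forall x y, (mdist x y < t)%R -> `|f x - f y|%:E <= F x + F y) ->
  modulus m p%:E f t <= ((2 `^ p * (2 * c ^+ 2)) `^ p^-1)%:E * 'N[m]_p%:E[F].
Proof.
move=> p0 t0 mF F0 fF.
pose k (z : X * X) : \bar R := (c * t `^ (- N) * (mdist z.1 z.2 < t)%R%:R)%:E.
pose G x := F x `^ p.
have G0 x : 0 <= G x by exact: poweR_ge0.
have mG : measurable_fun setT G by exact: (measurableT_comp (measurable_poweR _) mF).
have ct0 : (0 <= c * t `^ (- N))%R by rewrite mulr_ge0 ?powR_ge0// ltW.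
have k0 z : 0 <= k z by rewrite lee_fin mulr_ge0.
have mk : measurable_fun setT k.
  apply/measurable_EFinP; apply: measurable_funM => //; apply: measurable_indicator.
  by apply: measurable_fun_ltr => //; exact: measurable_mdist m_regular.
have kmass x : \int[m]_y k (x, y) <= (c ^+ 2)%:E.
  rewrite /k /= integral_dist_lt//.
  have /andP[_ mB] := m_ball x t0.
  apply: (le_trans (lee_wpmul2l _ mB)); first by rewrite lee_fin.
  rewrite -EFinM lee_fin powRN le_eqVlt; apply/orP; left; apply/eqP.
  by field; rewrite gt_eqF ?powR_gt0.
have kmass2 y : \int[m]_x k (x, y) <= (c ^+ 2)%:E.
  by under eq_integral do rewrite /k /= metric_sym; exact: kmass.
have mk1 x : measurable_fun setT (fun y => k (x, y)).
  exact: (measurableT_comp mk (measurable_pair1 x)).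
have mk2 y : measurable_fun setT (fun x => k (x, y)).
  exact: (measurableT_comp mk (measurable_pair2 y)).
have pw0 : 0 <= (2 `^ p)%:E :> \bar R by rewrite lee_fin powR_ge0.
have mkG : measurable_fun setT (fun z : X * X => k z * G z.2).
  by apply: emeasurable_funM => //; exact: (measurableT_comp mG measurable_snd).
have inner x : (fine (m (ball x t)))^-1%:E *
    \int[m]_(y in ball x t) (`|f x - f y| `^ p)%:E <=
    (2 `^ p)%:E * (\int[m]_y (k (x, y) * G x) + \int[m]_y (k (x, y) * G y)).
  have mB0 : (0 < c^-1 * t `^ N)%R by rewrite mulr_gt0 ?invr_gt0 ?powR_gt0.
  have /andP[mB1 mB2] := m_ball x t0.
  have mBfin : m (ball x t) \is a fin_num.
    by rewrite ge0_fin_numE//; apply: le_lt_trans mB2 _; rewrite ltry.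
  have fB : ((fine (m (ball x t)))^-1 <= c * t `^ (- N))%R.
    rewrite powRN -[leRHS]invrK invfM invrK lef_pV2 ?posrE//.
      by rewrite -lee_fin fineK.
    by rewrite -lte_fin fineK//; apply: lt_le_trans mB1; rewrite lte_fin.
  apply: (@le_trans _ _ ((c * t `^ (- N))%:E *
     \int[m]_y ((mdist x y < t)%R%:R%:E * ((2 `^ p)%:E * (G x + G y))))).
    apply: lee_pmul => //.
    - by rewrite lee_fin invr_ge0 fine_ge0.
    - by apply: integral_ge0 => y _; rewrite lee_fin powR_ge0.
    rewrite integral_mkcond; apply: ge0_le_integral_nomeas => y _; rewrite patchE.
      by case: ifP => // _; rewrite lee_fin powR_ge0.
    case: ifPn => [|_]; last by rewrite !mule_ge0 ?adde_ge0 ?lee_fin.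
    rewrite inE mem_ball => xy; rewrite xy mul1e -poweR_EFin.
    apply: le_trans (poweRD_le p0 (F0 x) (F0 y)).
    by apply: le_poweR; rewrite ?(ltW p0)// fF.
  rewrite -ge0_integralD//; last 4 first.
  - by move=> y _; rewrite mule_ge0.
  - exact: emeasurable_funM.
  - by move=> y _; rewrite mule_ge0.
  - exact: emeasurable_funM.
  rewrite -ge0_integralZl//; last 2 first.
  - by apply: emeasurable_funD; exact: emeasurable_funM.
  - by move=> y _; rewrite adde_ge0 ?mule_ge0.
  rewrite -ge0_integralZl//; last 2 first.
  - apply: emeasurable_funM; last by apply: emeasurable_funM => //; exact: emeasurable_funD.
    apply/measurable_EFinP; apply: measurable_indicator; apply: measurable_fun_ltr => //.
    exact: (@measurable_dist _ _ _ _ _ _ c_gt0 m_ball _ _ (cst x) id).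
  - by move=> y _; rewrite !mule_ge0 ?adde_ge0 ?lee_fin.
  apply: ge0_le_integral_nomeas => y _; first by rewrite !mule_ge0 ?adde_ge0 ?lee_fin.
  rewrite -ge0_muleDr// muleA -EFinM -/(k (x, y)) muleCA.
  by [].
rewrite unlock /= -/G.
under [X in _ <= _ * X `^ _]eq_integral do rewrite gee0_abs//.
have IG0 : 0 <= \int[m]_x G x by apply: integral_ge0.
rewrite -poweR_EFin -poweRM ?lee_fin ?mulr_ge0 ?powR_ge0 ?exprn_ge0 ?(ltW c_gt0)//.
apply: le_poweR; rewrite ?invr_ge0 ?(ltW p0)//.
  apply: integral_ge0 => x _; rewrite mule_ge0 ?lee_fin ?invr_ge0 ?fine_ge0//.
  by apply: integral_ge0 => y _; rewrite lee_fin powR_ge0.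
apply: (@le_trans _ _ (\int[m]_x ((2 `^ p)%:E *
    (\int[m]_y (k (x, y) * G x) + \int[m]_y (k (x, y) * G y))))).
  apply: ge0_le_integral_nomeas => x _; last exact: inner.
  rewrite mule_ge0 ?lee_fin ?invr_ge0 ?fine_ge0//.
  by apply: integral_ge0 => y _; rewrite lee_fin powR_ge0.
have mkG1 : measurable_fun setT (fun z : X * X => k z * G z.1).
  by apply: emeasurable_funM => //; exact: (measurableT_comp mG measurable_fst).
have kG0 (z : X * X) x : 0 <= k z * G x by rewrite mule_ge0.
have mU : measurable_fun setT (fun x => \int[m]_y (k (x, y) * G x)).
  exact: (measurable_fun_fubini_tonelli_F (fun z : X * X => k z * G z.1)).
have mV : measurable_fun setT (fun x => \int[m]_y (k (x, y) * G y)).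
  exact: (measurable_fun_fubini_tonelli_F (fun z : X * X => k z * G z.2)).
have U0 x : 0 <= \int[m]_y (k (x, y) * G x) by apply: integral_ge0.
have V0 x : 0 <= \int[m]_y (k (x, y) * G y) by apply: integral_ge0.
rewrite ge0_integralZl//; last 2 first.
- exact: emeasurable_funD.
- by move=> x _; rewrite adde_ge0.
rewrite EFinM -muleA; apply: lee_wpmul2l => //.
rewrite ge0_integralD// (_ : (2 * c ^+ 2)%:E = (c ^+ 2)%:E + (c ^+ 2)%:E); last first.
  by rewrite -EFinD; congr EFin; ring.
have c20 : 0 <= (c ^+ 2)%:E :> \bar R by rewrite lee_fin exprn_ge0// ltW.
have IGE : (c ^+ 2)%:E * \int[m]_x G x = \int[m]_x ((c ^+ 2)%:E * G x).
  by rewrite ge0_integralZl.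
rewrite ge0_muleDl//; apply: leeD.
  rewrite IGE; apply: ge0_le_integral_nomeas => x _; first exact: U0.
  have -> : \int[m]_y (k (x, y) * G x) = \int[m]_y k (x, y) * G x.
    by apply: ge0_integralZr.
  exact: lee_wpmul2r.
rewrite (@fubini_tonelli _ _ _ _ _ _ _ (fun z : X * X => k z * G z.2))//=.
rewrite IGE; apply: ge0_le_integral_nomeas => y _; first exact: integral_ge0.
have -> : \int[m]_x (k (x, y) * G y) = \int[m]_x k (x, y) * G y.
  by apply: ge0_integralZr.
exact: lee_wpmul2r.
Qed.

(** If [F <= M] off a null set [B], pairs with a coordinate in [B] are negligible: the product
    measure of [B] times the space is 0 even when the space has infinite measure. So 2 M is one of
    the bounds in the infimum. *)
Lemma modulus_y_le (t : R) (f : X -> R) (F : X -> \bar R) :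
  measurable_fun setT F -> (forall x, 0 <= F x) ->
  (forall x y, (mdist x y < t)%R -> `|f x - f y|%:E <= F x + F y) ->
  modulus m +oo f t <= 2%:E * 'N[m]_(+oo)[F].
Proof.
move=> mF F0 fF; rewrite unlock m_gt0 /=; set M := ess_sup m _.
apply: ereal_inf_lbound => /=.
have [B [mB B0 FB]] := ess_sup_ge m (abse \o F).
exists (B `*` setT `|` setT `*` B); split.
- by apply: measurableU; exact: measurableX.
- have mBT : measurable (B `*` [set: X]) by exact: measurableX.
  have mTB : measurable ([set: X] `*` B) by exact: measurableX.
  have zBT : (m \x m) (B `*` [set: X]) = 0.
    by rewrite product_measure1E// B0 mul0e.
  have zTB : (m \x m) ([set: X] `*` B) = 0.
    by rewrite product_measure1E// B0 mule0.
  exact: etrans (measureU0 mBT mTB zTB) zBT.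
- move=> [x y] /= h; apply: contrapT => /not_orP[nx ny]; apply: h => xy.
  have Bx : ~ B x by move=> Bx; exact: nx.
  have By : ~ B y by move=> By; exact: ny.
  have Fx : F x <= M.
    by rewrite -[F x]gee0_abs//; apply: contrapT => h; apply: Bx; exact: FB.
  have Fy : F y <= M.
    by rewrite -[F y]gee0_abs//; apply: contrapT => h; apply: By; exact: FB.
  apply: (le_trans (fF _ _ xy)).
  have M0 := le_trans (F0 x) Fx.
  by rewrite (_ : 2%:E = 1 + 1)// ge0_muleDl// !mul1e leeD.
Qed.

Lemma modulus_le (p : \bar R) : 1 <= p -> exists2 C : R, (0 < C)%R &
  forall (t : R) (f : X -> R) (F : X -> \bar R), (0 < t)%R ->
  measurable_fun setT F -> (forall x, 0 <= F x) ->
  (forall x y, (mdist x y < t)%R -> `|f x - f y|%:E <= F x + F y) ->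
  modulus m p f t <= C%:E * 'N[m]_p[F].
Proof.
case: p => [p|_|//]; last first.
  by exists 2%R => // t f F t0; exact: modulus_y_le.
rewrite lee_fin => p1; have p0 : (0 < p)%R by apply: lt_le_trans p1.
exists ((2 `^ p * (2 * c ^+ 2)) `^ p^-1)%R => [|t f F t0].
  by rewrite powR_gt0// !mulr_gt0 ?powR_gt0 ?exprn_gt0.
exact: modulus_fin_le.
Qed.
End modulus_bound.

Lemma ae_le_Lnorm d (T : measurableType d) (R : realType)
    (mu : {measure set T -> \bar R}) (p : \bar R) (f g : T -> \bar R) :
  (1 <= p)%E -> measurable_fun setT f -> measurable_fun setT g ->
  {ae mu, forall x, (`|f x| <= `|g x|)%E} -> ('N[mu]_p[f] <= 'N[mu]_p[g])%E.
Proof.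
move=> p1 mf mg fg; rewrite unlock; case: p p1 => [p| |//].
  rewrite lee_fin => p1; have p0 : 0 <= p by apply: le_trans p1.
  apply: le_poweR; rewrite ?invr_ge0//.
    by apply: integral_ge0 => x _; exact: poweR_ge0.
  have mpow (k : T -> \bar R) : measurable_fun setT k ->
      measurable_fun setT (fun x => `|k x| `^ p)%E.
    by move=> mk; apply: (measurableT_comp (measurable_poweR _)); exact: measurableT_comp.
  apply: ae_ge0_le_integral => //.
  - by move=> x _; exact: poweR_ge0.
  - exact: mpow.
  - by move=> x _; exact: poweR_ge0.
  - exact: mpow.
  - by apply: filterS fg => x fgx _; exact: le_poweR.
by move=> _; case: ifP => // _; exact: le_ess_sup.
Qed.

(** * Norm and modulus of a potential *)

Section bessel_besov.
Context {R : realType} d (X : borelMetricType d R).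
Variables (m : {sigma_finite_measure set X -> \bar R}) (N c L : R) (h : R -> R).
Hypothesis c_gt0 : 0 < c.
Hypothesis m_ball : forall (x : X) (r : R), 0 < r ->
  ((c^-1 * r `^ N)%:E <= m (ball x r) <= (c * r `^ N)%:E)%E.
Hypothesis m_gt0 : (0 < m setT)%E.
Hypothesis h01 : forall x, 0 <= h x <= 1.
Hypothesis h_near : forall x, x <= 2^-1 -> h x = 1.
Hypothesis h_far : forall x, 2 <= x -> h x = 0.
Hypothesis h_lip : forall x y, `|h x - h y| <= L * `|x - y|.
Hypothesis L_ge0 : 0 <= L.
Variables (p : \bar R) (a : R).
Hypothesis p_ge1 : (1 <= p)%E.
Hypothesis a01 : 0 < a < 1.
Local Open Scope ereal_scope.

(** With the weight [split_weight a r] this is the majorant F of the overview at distance r; with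
    [weight a 1] it majorises |J_a g|. *)
Let smear (C : R) (w : R -> R) (g : X -> R) (x : X) : \bar R :=
  \int[m]_z (`|g z|%:E * (C%:E * radial_kernel N w (x, z))).

Let measurable_smear_kernel (C : R) (w : R -> R) : measurable_fun setT w ->
  (forall v, 0 <= v -> 0 <= w v)%R ->
  measurable_fun setT (fun z : X * X => C%:E * radial_kernel N w z).
Proof.
move=> mw w0; apply: emeasurable_funM => //.
exact: (measurable_radial_kernel c_gt0 m_ball).
Qed.

Let measurable_smear (C : R) (w : R -> R) (g : X -> R) : (0 <= C)%R ->
  measurable_fun setT w -> (forall v, 0 <= v -> 0 <= w v)%R ->
  measurable_fun setT g -> measurable_fun setT (smear C w g).
Proof.
move=> C0 mw w0 mg.
apply: (measurable_fun_fubini_tonelli_F (fun z : X * X =>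
  `|g z.2|%:E * (C%:E * radial_kernel N w z))).
  apply: emeasurable_funM; last exact: measurable_smear_kernel.
  apply/measurable_EFinP; apply: measurableT_comp => //.
  exact: (measurableT_comp mg measurable_snd).
by move=> z; rewrite !mule_ge0 ?lee_fin ?radial_kernel_ge0.
Qed.

Let smear_ge0 (C : R) (w : R -> R) (g : X -> R) x : (0 <= C)%R ->
  (forall v, 0 <= v -> 0 <= w v)%R -> 0 <= smear C w g x.
Proof.
move=> C0 w0; apply: integral_ge0 => z _.
by rewrite !mule_ge0 ?lee_fin ?radial_kernel_ge0.
Qed.

Let Lnorm_smear_le (C W : R) (w : R -> R) (g : X -> R) : (0 < C)%R -> (0 < W)%R ->
  measurable_fun setT w -> (forall v, 0 <= v -> 0 <= w v)%R ->
  measurable_fun setT g ->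
  \int[lebesgue_measure]_(u in `]0%R, +oo[) (w u)%:E <= W%:E ->
  'N[m]_p[smear C w g] <= (C * (c * 4 `^ N * W))%:E * 'N[m]_p[EFin \o g].
Proof.
move=> C0 W0 mw w0 mg wW.
have mass x : \int[m]_z (C%:E * radial_kernel N w (x, z)) <= (C * (c * 4 `^ N * W))%:E.
  rewrite ge0_integralZl//; last 3 first.
  - apply: measurableT_comp (measurable_pair1 x).
    exact: (measurable_radial_kernel c_gt0 m_ball).
  - by move=> z _; exact: radial_kernel_ge0.
  - by rewrite lee_fin ltW.
  rewrite EFinM; apply: lee_wpmul2l; first by rewrite lee_fin ltW.
  exact: (radial_kernel_mass c_gt0 m_ball).
apply: (schur_test (K := fun z => C%:E * radial_kernel N w z)) => //.
- by rewrite !mulr_gt0 ?powR_gt0.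
- exact: measurable_smear_kernel.
- by move=> z; rewrite mule_ge0 ?lee_fin ?(ltW C0)// radial_kernel_ge0.
- by move=> z; under eq_integral do rewrite radial_kernelC; exact: mass.
Qed.

(** Two bounds on the modulus give the minimum: the one uniform in [t] takes |f| itself as majorant,
    the one of order t^a takes the smear with [split_weight a t]. [A1] and [A2] are the Schur
    constants of the two weights, and the final constant sums all that occur. *)
Lemma potential_bounds : exists2 A : R, (0 < A)%R & forall f g : X -> R,
  measurable_fun setT f -> measurable_fun setT g -> is_potential m N h a g f ->
  'N[m]_p[EFin \o f] <= A%:E * 'N[m]_p[EFin \o g] /\
  forall t : R, (0 < t)%R ->
    modulus m p f t <= (A * Num.min 1 (t `^ a))%:E * 'N[m]_p[EFin \o g].
Proof.
have /andP[a0 a1] := a01; have a10 : (0 < 1 - a)%R by rewrite subr_gt0.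
have [C C0 [k_le k_diff]] :=
  bessel_kernel_bounds c_gt0 m_ball h01 h_near h_far h_lip a01 L_ge0.
have [D D0 mod_le] := modulus_le c_gt0 m_ball m_gt0 p_ge1.
have c4 : (0 < c * 4 `^ N)%R by rewrite mulr_gt0 ?powR_gt0.
pose A1 := (C * (c * 4 `^ N * a^-1))%R.
pose A2 := (C * (c * 4 `^ N * (4 * (a^-1 + (1 - a)^-1))))%R.
have A10 : (0 < A1)%R by rewrite !mulr_gt0 ?invr_gt0 ?powR_gt0.
have A20 : (0 < A2)%R by rewrite !mulr_gt0 ?addr_gt0 ?invr_gt0 ?powR_gt0.
have DA1 : (0 < D * A1)%R by exact: mulr_gt0.
have DA2 : (0 < D * A2)%R by exact: mulr_gt0.
exists (A1 + D * A1 + D * A2)%R; first by apply: addr_gt0 => //; exact: addr_gt0.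
move=> f g mf mg [B [mB B0 fgB]].
have mk := measurable_bessel_kernel c_gt0 m_ball h01 h_lip a.
have k0 x y : 0 <= bessel_kernel m N h a x y by exact: bessel_kernel_ge0.
have fgE x : ~ B x -> bessel_potential m N h a g x = (f x)%:E.
  by move=> nB; apply: contrapT => nE; apply: nB; exact: fgB.
have w0 (v : R) : (0 <= v)%R -> (0 <= weight a 1 v)%R by exact: weight_ge0.
have s0 (r v : R) : (0 <= v)%R -> (0 <= split_weight a r v)%R by exact: split_weight_ge0.
have mw := @measurable_weight R a 1; have ms r := @measurable_split_weight R a r.
have C0' := ltW C0.
have f_le x : ~ B x -> `|f x|%:E <= smear C (weight a 1) g x.
  move=> /fgE fx.
  apply: (@le_trans _ _ (\int[m]_z (`|g z|%:E * bessel_kernel m N h a x z))); last first.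
    apply: ge0_le_integral_nomeas => z _; first by rewrite mule_ge0.
    by apply: lee_wpmul2l => //; rewrite k_le.
  (* The size bound is the difference bound against the zero kernel, whose potential is 0, used in
     both directions to obtain the absolute value. *)
  have z0 : \int[m]_z ((g z)%:E * (cst 0 z : \bar R)) = 0%:E.
    by apply: integral0_eq => z _; rewrite mule0.
  have up z : bessel_kernel m N h a x z <= cst 0 z + bessel_kernel m N h a x z.
    by rewrite /= add0e.
  have dn z : cst 0 z <= bessel_kernel m N h a x z + bessel_kernel m N h a x z.
    by rewrite /= adde_ge0.
  have c0 (z : X) : 0 <= (cst 0 z : \bar R) by [].
  have mc : measurable_fun setT (cst 0 : X -> \bar R) by exact: measurable_cst.
  have h1 := integral_diff_le mg (mk x) mc (mk x) (k0 x) c0 (k0 x) up dn fx z0.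
  have h2 := integral_diff_le mg mc (mk x) (mk x) c0 (k0 x) (k0 x) dn up z0 fx.
  rewrite add0e in h1.
  move: h1 h2; case: (\int[m]_z _) => [I| |] //=; rewrite ?leey//.
  by rewrite -EFinD !lee_fin ler_norml => ? ?; apply/andP; split; lra.
have f_diff r x y : (0 < r)%R -> (mdist x y < r)%R -> ~ B x -> ~ B y ->
    `|f x - f y|%:E <= smear C (split_weight a r) g x + smear C (split_weight a r) g y.
  move=> r0 xy /fgE fx /fgE fy.
  pose q z := C%:E * radial_kernel N (split_weight a r) (x, z) +
              C%:E * radial_kernel N (split_weight a r) (y, z).
  have mK (u : X) : measurable_fun setT (fun z => C%:E * radial_kernel N (split_weight a r) (u, z)).
    exact: (measurableT_comp (measurable_smear_kernel C (ms r) (s0 r)) (measurable_pair1 u)).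
  have mq : measurable_fun setT q by apply: emeasurable_funD; exact: mK.
  have K0 u z : 0 <= C%:E * radial_kernel N (split_weight a r) (u, z).
    by rewrite mule_ge0 ?lee_fin// radial_kernel_ge0//; exact: s0.
  have q0 z : 0 <= q z by rewrite adde_ge0 ?K0.
  have qE : smear C (split_weight a r) g x + smear C (split_weight a r) g y =
      \int[m]_z (`|g z|%:E * q z).
    have mng : measurable_fun setT (fun z => `|g z|%:E).
      by apply/measurable_EFinP; exact: measurableT_comp.
    rewrite -ge0_integralD//.
    - by apply: eq_integral => z _; apply/esym; apply: ge0_muleDr; exact: K0.
    - by move=> z _; apply: mule_ge0 => //; exact: K0.
    - by apply: emeasurable_funM => //; exact: mK.
    - by move=> z _; apply: mule_ge0 => //; exact: K0.
    - by apply: emeasurable_funM => //; exact: mK.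
  have kq z : bessel_kernel m N h a x z <= bessel_kernel m N h a y z + q z.
    rewrite /q -ge0_muleDr; try by apply: radial_kernel_ge0; exact: s0.
    exact: k_diff.
  have kq' z : bessel_kernel m N h a y z <= bessel_kernel m N h a x z + q z.
    rewrite /q -ge0_muleDr; try by apply: radial_kernel_ge0; exact: s0.
    by rewrite [X in C%:E * X]addeC; apply: k_diff => //; rewrite metric_sym.
  have h1 := integral_diff_le mg (mk x) (mk y) mq (k0 x) (k0 y) q0 kq kq' fx fy.
  have h2 := integral_diff_le mg (mk y) (mk x) mq (k0 y) (k0 x) q0 kq' kq fy fx.
  rewrite qE; move: h1 h2; case: (\int[m]_z _) => [I| |] //=; rewrite ?leey//.
  by rewrite -!EFinD !lee_fin ler_norml => ? ?; apply/andP; split; lra.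
have aeB (P : X -> Prop) : (forall x, ~ B x -> P x) -> {ae m, forall x, P x}.
  move=> BP; exists B; split => // x /= nP; apply: contrapT => nB.
  by apply: nP; exact: BP.
have N0 : 0 <= 'N[m]_p[EFin \o g] by exact: Lnorm_ge0.
have f_norm : 'N[m]_p[EFin \o f] <= A1%:E * 'N[m]_p[EFin \o g].
  apply: (@le_trans _ _ 'N[m]_p[smear C (weight a 1) g]).
    apply: ae_le_Lnorm => //; [exact/measurable_EFinP|exact: measurable_smear|].
    apply: aeB => x /f_le fx /=.
    by rewrite [leRHS]gee0_abs// smear_ge0.
  apply: Lnorm_smear_le => //; first by rewrite invr_gt0.
  exact: integral_weight_le.
split.
  apply: (le_trans f_norm); apply: lee_wpmul2r => //.
  by rewrite lee_fin -addrA lerDl addr_ge0// mulr_ge0// ltW.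
move=> t t0.
have ta0 := powR_ge0 t a.
have mod1 : modulus m p f t <= (D * A1)%:E * 'N[m]_p[EFin \o g].
  rewrite EFinM -muleA; apply: le_trans (lee_wpmul2l _ f_norm); last by rewrite lee_fin ltW.
  rewrite -Lnorm_abse; apply: mod_le => //.
  - by apply: measurableT_comp => //; exact/measurable_EFinP.
  - by move=> x; exact: abse_ge0.
  - by move=> x y _; rewrite -EFinD lee_fin ler_normB.
have mod2 : modulus m p f t <= (D * (A2 * t `^ a))%:E * 'N[m]_p[EFin \o g].
  (* With [F = +oo] on the exceptional null set, the bound holds everywhere. *)
  pose F x := if x \in B then +oo else smear C (split_weight a t) g x.
  have mF : measurable_fun setT F.
    apply: measurable_fun_ifT => //; last exact: (measurable_smear C0' (ms t) (s0 t)).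
    apply: (@measurable_fun_bool _ _ _ _ true); rewrite setTI (_ : _ @^-1` _ = B)//.
    by apply/seteqP; split => x /=; [move/set_mem|move/mem_set].
  have F0 x : 0 <= F x by rewrite /F; case: ifP => // _; apply: smear_ge0 => //; exact: s0.
  have F_norm : 'N[m]_p[F] <= (A2 * t `^ a)%:E * 'N[m]_p[EFin \o g].
    apply: (@le_trans _ _ 'N[m]_p[smear C (split_weight a t) g]).
      apply: ae_le_Lnorm => //; first exact: (measurable_smear C0' (ms t) (s0 t)).
      by apply: aeB => x nB; rewrite /F memNset.
    have -> : (A2 * t `^ a = C * (c * 4 `^ N * (4 * t `^ a * (a^-1 + (1 - a)^-1))))%R.
      by rewrite /A2; ring.
    apply: (Lnorm_smear_le C0 _ (ms t) (s0 t) mg (integral_split_weight_le a01 t0)).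
    by rewrite !mulr_gt0 ?powR_gt0 ?addr_gt0 ?invr_gt0.
  rewrite EFinM -muleA; apply: le_trans (lee_wpmul2l _ F_norm); last by rewrite lee_fin ltW.
  apply: mod_le => // x y xy; rewrite /F.
  have [xB|xB] := boolP (x \in B); first by rewrite addye ?leey// gt_eqF// (lt_le_trans _ (F0 y)).
  have [yB|yB] := boolP (y \in B).
    have sx0 : 0 <= smear C (split_weight a t) g x by apply: smear_ge0 => //; exact: s0.
    by rewrite addey ?leey// -ltNye (lt_le_trans _ sx0).
  by move: xB yB; rewrite !notin_setE => xB yB; exact: f_diff.
have [_|_] := leP 1%R (t `^ a)%R.
  rewrite mulr1; apply: (le_trans mod1); apply: lee_wpmul2r => //.
  by rewrite lee_fin addrAC lerDr (addr_ge0 (ltW A10) (ltW DA2)).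
apply: (le_trans mod2); apply: lee_wpmul2r => //.
by rewrite lee_fin mulrA ler_wpM2r// lerDr (addr_ge0 (ltW A10) (ltW DA1)).
Qed.
End bessel_besov.

(** * Besov norms *)

Section besov_bounds.
Context {R : realType} d (X : borelMetricType d R).
Variable m : {sigma_finite_measure set X -> \bar R}.
Local Open Scope ereal_scope.

(* The infimum defining [modulus +oo] is [-oo] when almost no pair of points
   is within distance [t]. *)
Lemma modulus_ge0VNy (p : \bar R) (f : X -> R) (t : R) :
  0 <= modulus m p f t \/ modulus m p f t = -oo.
Proof.
rewrite /modulus; set S := [set y | _].
suff infS : 0 <= ereal_inf S \/ ereal_inf S = -oo.
  by case: p => [p| |] //; left; exact: poweR_ge0.
have [SNy|SNy] := pselect (S -oo).
  by right; apply/eqP; rewrite -leeNy_eq; exact: ereal_inf_lbound.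
left; apply: le_ereal_inf_tmp => y Sy; rewrite leNgt; apply/negP => y0; apply: SNy.
apply: filterS Sy => z fz zt; have := le_lt_trans (fz zt) y0.
by rewrite lte_fin ltNge normr_ge0.
Qed.

(** A positive power of -oo is 0 by convention, so monotonicity survives the degenerate value of the
    modulus. *)
Lemma le_poweR_modulus (p : \bar R) (f : X -> R) (t q : R) (v : \bar R) :
  (0 < q)%R -> 0 <= v -> modulus m p f t <= v -> modulus m p f t `^ q <= v `^ q.
Proof.
move=> q0 v0; have [mod0|->] := modulus_ge0VNy p f t.
  exact: le_poweR (ltW q0) mod0.
by move=> _; rewrite poweRNyr ?gt_eqF// poweR_ge0.
Qed.

Variables (p : \bar R) (a A : R) (f : X -> R) (V : \bar R).
Hypothesis A_gt0 : (0 < A)%R.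
Hypothesis V_ge0 : 0 <= V.
Hypothesis f_le : 'N[m]_p[EFin \o f] <= A%:E * V.
Hypothesis modulus_f_le : forall t : R, (0 < t)%R ->
  modulus m p f t <= (A * Num.min 1 (t `^ a))%:E * V.

Lemma besov_norm_y_le : besov_norm m a p +oo f <= (A + A)%:E * V.
Proof.
rewrite EFinD ge0_muleDl ?lee_fin ?(ltW A_gt0)//; apply: leeD => //.
apply: ge_ereal_sup => s [t /=]; rewrite in_itv/= andbT => t0 <-.
have ta0 : (0 < t `^ a)%R by rewrite powR_gt0.
apply: (le_trans (lee_wpmul2l _ (modulus_f_le t0))).
  by rewrite lee_fin powR_ge0.
rewrite muleA; apply: lee_wpmul2r => //.
rewrite -EFinM lee_fin powRN mulrCA -[leRHS]mulr1 ler_wpM2l ?(ltW A_gt0)//.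
by rewrite mulrC ler_pdivrMr// mul1r ge_min lexx orbT.
Qed.

(** The integrand is of order t^(eq-1) below 1 and t^(-(a-e)q-1) above 1, both covered by weights
    with r = 1. Their integrals give the two inverses in the constant: [0 < e] serves at 0, [e < a]
    at infinity. *)
Lemma besov_norm_fin_le (q e : R) : (1 <= q)%R -> (0 < e < a)%R ->
  besov_norm m (a - e) p q%:E f <=
  (A + (A `^ q * (4 * ((e * q)^-1 + ((a - e) * q)^-1))) `^ q^-1)%:E * V.
Proof.
move=> q1 /andP[e0 ea]; have q0 : (0 < q)%R by apply: lt_le_trans q1.
have a0 : (0 < a)%R by apply: lt_trans ea.
set b := (a - e)%R; have b0 : (0 < b)%R by rewrite subr_gt0.
have eq0 : (0 < e * q)%R by rewrite mulr_gt0.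
have bq0 : (0 < b * q)%R by rewrite mulr_gt0.
have [D DE] : exists D, D = (4 * ((e * q)^-1 + (b * q)^-1))%R by eexists.
have D0 : (0 <= D)%R by rewrite DE mulr_ge0// addr_ge0// invr_ge0 ltW.
rewrite -DE.
rewrite EFinD ge0_muleDl ?lee_fin ?powR_ge0 ?(ltW A_gt0)//; apply: leeD => //.
have Aq0 := powR_ge0 A q.
(* Both sides become powers with exponent 1/q, so that the integrals can be compared. *)
have -> : ((A `^ q * D) `^ q^-1)%:E * V = ((A `^ q * D)%:E * V `^ q) `^ q^-1.
  rewrite poweRM ?lee_fin ?mulr_ge0 ?poweR_ge0// poweR_EFin; congr (_ * _).
  by rewrite -poweRrM divff ?poweRe1// gt_eqF.
pose w t : R := (weight (e * q) 1 t + weight (b * q) 1 t)%R.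
have w0 t : (0 < t)%R -> (0 <= w t)%R by move=> /ltW t0; rewrite addr_ge0 ?weight_ge0.
have key t : (0 < t)%R ->
    (t `^ (- (b * q)) * Num.min 1 (t `^ a) `^ q * t^-1 <= 4 * w t)%R.
  move=> t0; have t0' := ltW t0; rewrite /w mulrDr.
  have we0 : (0 <= weight (e * q) 1 t)%R by rewrite weight_ge0.
  have wb0 : (0 <= weight (b * q) 1 t)%R by rewrite weight_ge0.
  have [t1|t1] := leP 1%R t.
    have -> : Num.min 1%R (t `^ a)%R = 1%R.
      by apply: min_l; rewrite -(powRr0 t); apply: ler_powR => //; exact: ltW.
    rewrite powR1 mulr1 powRN.
    have := weight_le_r bq0 ltr01 t1; rewrite powR1 mul1r => h.
    by apply: (le_trans h); rewrite lerDr mulr_ge0.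
  have -> : Num.min 1%R (t `^ a)%R = (t `^ a)%R.
    apply: min_r; have <- : (1 `^ a)%R = 1%R :> R by rewrite powR1.
    by apply: ge0_ler_powR; rewrite ?nnegrE ?(ltW a0) ?(ltW t1).
  rewrite -powRrM -powRD; last by apply/implyP => _; rewrite gt_eqF.
  have -> : (- (b * q) + a * q = e * q)%R by rewrite /b; ring.
  have := weight_le_l eq0 t0 (ltW t1); rewrite powR1 mulr1 => h.
  by apply: (le_trans h); rewrite lerDl mulr_ge0.
apply: le_poweR; rewrite ?invr_ge0 ?(ltW q0)//.
  apply: integral_ge0 => t; rewrite /= in_itv/= andbT => t0.
  by rewrite !mule_ge0 ?poweR_ge0 ?lee_fin ?powR_ge0// invr_ge0 ltW.
have K0 : 0 <= (A `^ q)%:E * V `^ q by rewrite mule_ge0 ?lee_fin ?poweR_ge0.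
apply: (@le_trans _ _ (\int[lebesgue_measure]_(t in `]0%R, +oo[)
    (((A `^ q)%:E * V `^ q) * (4 * w t)%:E))).
  apply: ge0_le_integral_nomeas => t; rewrite /= in_itv/= andbT => t0.
    by rewrite !mule_ge0 ?poweR_ge0 ?lee_fin ?powR_ge0// invr_ge0 ltW.
  have min0 : (0 <= Num.min 1 (t `^ a))%R by rewrite le_min ler01 powR_ge0.
  have modq : modulus m p f t `^ q <= ((A * Num.min 1 (t `^ a)) `^ q)%:E * V `^ q.
    rewrite -poweR_EFin -poweRM ?lee_fin ?mulr_ge0 ?(ltW A_gt0)//.
    apply: le_poweR_modulus => //; last exact: modulus_f_le.
    by rewrite mule_ge0 ?lee_fin ?mulr_ge0 ?(ltW A_gt0).
  apply: (@le_trans _ _ ((t `^ (- (b * q)))%:E *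
      (((A * Num.min 1 (t `^ a)) `^ q)%:E * V `^ q) * (t^-1)%:E)).
    apply: lee_wpmul2r; first by rewrite lee_fin invr_ge0 ltW.
    by apply: lee_wpmul2l => //; rewrite lee_fin powR_ge0.
  rewrite muleA -EFinM muleAC -EFinM [leRHS]muleAC -EFinM.
  apply: lee_wpmul2r; first exact: poweR_ge0.
  rewrite lee_fin powRM ?(ltW A_gt0)//.
  rewrite [leLHS](_ : _ = A `^ q * (t `^ (- (b * q)) * Num.min 1 (t `^ a) `^ q * t^-1))%R; last by ring.
  by apply: ler_wpM2l => //; exact: key.
have mw : measurable_fun (`]0%R, +oo[%classic : set (measurableTypeR R)) (fun t => (w t)%:E).
  apply: measurable_funTS; apply/measurable_EFinP.
  by apply: measurable_funD; exact: measurable_weight.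
rewrite ge0_integralZl//; last 2 first.
- apply: measurable_funTS; apply/measurable_EFinP; apply: measurable_funM => //.
  by apply: measurable_funD; exact: measurable_weight.
- by move=> t; rewrite /= in_itv/= andbT => t0; rewrite lee_fin mulr_ge0 ?w0.
rewrite [leRHS](_ : _ = (A `^ q)%:E * V `^ q * D%:E); last by rewrite EFinM muleAC.
apply: lee_wpmul2l => //.
under eq_integral do rewrite EFinM.
rewrite ge0_integralZl//; last by move=> t; rewrite /= in_itv/= andbT => t0; rewrite lee_fin w0.
rewrite DE EFinM; apply: lee_wpmul2l => //.
exact: integral_weightD_le.
Qed.
End besov_bounds.

(** Closeness in the potential norm puts the infimum for [u \- f] below [e / A]; it therefore
    supplies a [g] of small norm whose potential is the difference itself, and the bound applies to
    that pair. *)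
Lemma embedding_of_potential_bound (R : realType) d (X : borelMetricType d R)
    (m : {measure set X -> \bar R}) (N : R) (h : R -> R) (a : R) (p : \bar R)
    (normB : (X -> R) -> \bar R) (A : R) : 0 < A ->
  (forall f g : X -> R, measurable_fun setT f -> measurable_fun setT g ->
    is_potential m N h a g f -> (normB f <= A%:E * 'N[m]_p[EFin \o g])%E) ->
  continuously_embedded (potential_space m N h a p) (potential_norm m N h a p)
    [set f | measurable_fun setT f /\ (normB f < +oo)%E] normB.
Proof.
move=> A0 bound.
have LfunP g : g \in Lfun m p ->
    measurable_fun setT g /\ ('N[m]_p[EFin \o g] < +oo)%E.
  rewrite inE => /andP[mg fg]; split; first by move: mg; rewrite inE.
  by move: fg; rewrite inE.
split=> [f [mf [g /LfunP[mg gfin] gf]]|f [mf _] e e0].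
  split => //; apply: (le_lt_trans (bound _ _ mf mg gf)).
  by rewrite lte_mul_pinfty// ?lee_fin ltW.
exists (e / A) => [|u [mu _] ufe]; first by rewrite divr_gt0.
have muf : measurable_fun setT (u \- f) by exact: measurable_funB.
have : (ereal_inf [set 'N[m]_p[EFin \o g] |
    g in [set g | g \in Lfun m p /\ is_potential m N h a g (u \- f)%R]] < (e / A)%:E)%E.
  apply: le_lt_trans ufe; rewrite /potential_norm.
  by rewrite leeDr// Lnorm_ge0.
move=> /ereal_inf_lt[_ [g [/LfunP[mg _] gu] <-] gA].
apply: (le_lt_trans (bound _ _ muf mg gu)).
by rewrite -[e](divfK (lt0r_neq0 A0)) mulrC EFinM lte_pmul2l.
Qed.

(** The kernels evaluate the cutoff only at distances divided by some t > 0, so [h] may be exchanged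
    for its globally Lipschitz version. *)
Lemma is_potential_eq (R : realType) d (X : borelMetricType d R)
    (m : {measure set X -> \bar R}) (N a : R) (h h' : R -> R) :
  (forall r, 0 <= r -> h r = h' r) -> is_potential m N h a = is_potential m N h' a.
Proof.
move=> hh'.
have hd (x y : X) t : 0 < t -> h (mdist x y / t) = h' (mdist x y / t).
  by move=> t0; rewrite hh'// divr_ge0 ?mdist_ge0// ltW.
have avE t : 0 < t -> averaging m N h t = averaging m N h' t.
  move=> t0; apply/funext => f; apply/funext => x; congr (_ * _).
  by apply: eq_Rintegral => y _; rewrite hd.
have kE : bessel_kernel m N h a = bessel_kernel m N h' a.
  apply/funext => x; apply/funext => y; rewrite /bessel_kernel.
  apply: (congr1 (fun v => (a%:E * v)%E)); apply: eq_integral => t; rewrite inE/= in_itv/= andbT => t0.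
  have phiE : phi m N h t = phi m N h' t by apply/funext => z; rewrite /phi avE.
  have psiE : psi m N h t = psi m N h' t by apply/funext => z; rewrite /psi phiE avE.
  have -> : approx_kernel m N h t x y = approx_kernel m N h' t x y.
    rewrite /approx_kernel phiE psiE; congr (_ * _).
    by apply: eq_Rintegral => z _; rewrite !hd.
  by [].
by rewrite /is_potential /bessel_potential kE.
Qed.

Unset Implicit Arguments.

Theorem corollary4p10 (R : realType) (d : measure_display)
    (X : borelMetricType d R) (m : {measure set X -> \bar R})
    (N : R) (h : R -> R) (p : \bar R) (a : R)
    (mX : m setT = +oo%E) (N_gt0 : 0 < N) (m_regular : ahlfors_regular m N)
    (h_cutoff : cutoff h) (p_ge1 : (1 <= p)%E) (a_bounds : 0 < a < 1) :
  (forall q e : R, 1 <= q -> 0 < e < a ->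
     continuously_embedded
       (potential_space m N h a p) (potential_norm m N h a p)
       (besov_space m (a - e) p q%:E) (besov_norm m (a - e) p q%:E)) /\
  continuously_embedded
    (potential_space m N h a p) (potential_norm m N h a p)
    (besov_space m a p +oo%E) (besov_norm m a p +oo%E).
Proof.
have [m' mE] := sigma_finite_measure_of (sigma_finite_ahlfors m_regular).
rewrite mE in mX m_regular *.
have m_gt0 : (0 < m' setT)%E by rewrite mX.
have [c c0 m_ball] := m_regular.
have [H [L [L0 hH H01 H_far [H_near H_lip]]]] := cutoff_lipschitz h_cutoff.
have [A A0 pot] := potential_bounds c0 m_ball m_gt0 H01 H_near H_far H_lip (ltW L0) p_ge1 a_bounds.
have V0 g : (0 <= 'N[m']_p[EFin \o g])%E by exact: Lnorm_ge0.
(* The bounds hold for potentials built from [H]; here they return to [h]. *)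
rewrite -(is_potential_eq m' N a hH) in pot.
split=> [q e q1 ea|].
- pose D := A + (A `^ q * (4 * ((e * q)^-1 + ((a - e) * q)^-1))) `^ q^-1.
  have D0 : 0 < D by rewrite ltr_pwDl ?powR_ge0.
  apply: (embedding_of_potential_bound D0) => f g mf mg gf.
  have [f_le mod_le] := pot f g mf mg gf.
  exact: besov_norm_fin_le.
- have AA0 : 0 < A + A by rewrite addr_gt0.
  apply: (embedding_of_potential_bound AA0) => f g mf mg gf.
  have [f_le mod_le] := pot f g mf mg gf.
  exact: besov_norm_y_le.
Qed.
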